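(* Fix $\nu$. Suppose the error assumptions (E1)–(E5) and (E7) and the regressor condition (R) hold, the coefficients decay geometrically, i.e. $\max_{\ell}\max_{\nu'}\|\mathbf c_j^{(\ell,\nu')}\|_\infty=O(\rho^j)$ for some $0\le\rho<1$, and $|x_{tj}\epsilon_t^{(\nu')}|\le1$ for all $t$, $j=1,\dots,p$ and $\nu'\ge1$. Then $\widehat{\boldsymbol\beta}_{T\nu}\to\boldsymbol\beta_\nu$ in probability as $T,p\to\infty$, provided $p\log(p)/T=o(1)$ and $\log^2(T)/\sqrt p=o(1)$.
   Context: Setting: $p=p_T$ may grow with $T$. Regressors $\mathbf x_t\in\mathbb R^p$, spatial locations $\mathbf s_t\in[0,1]^q$, responses $Y_t^{(\nu)}=\mathbf x_t^\top\boldsymbol\beta_\nu+\epsilon_t^{(\nu)}$, $\nu=1,\dots,d$, $t=1,\dots,T$. $\mathbb P$ is conditional on the regressors. $\mathbb X_T=(\mathbf x_1,\dots,\mathbf x_T)^\top$ full rank, $\widehat{\boldsymbol\beta}_{T\nu}=(\mathbb X_T^\top\mathbb X_T)^{-1}\mathbb X_T^\top(Y_1^{(\nu)},\dots,Y_T^{(\nu)})^\top$. (R): regressors bounded; there exist positive definite $\Sigma_{\mathbf x}$, $\eta\ge0$, $C<\infty$, compact interval $A\subset(0,\infty)$, independent of $T,p$, with $\|T^{-1}\sum_t\mathbf x_t\mathbf x_t^\top-\Sigma_{\mathbf x}\|_2\le Cp^\eta/\sqrt T$ and $\operatorname{spec}(T^{-1}\mathbb X_T^\top\mathbb X_T)\subset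 A$. Error model: $\boldsymbol\epsilon_t=\mathbf H(\mathbf U_t(\mathbf s_t),\dots,\mathbf U_{t-m}(\mathbf s_t))-\mathbb E\,\mathbf H(\mathbf U_t(\mathbf s_t),\dots,\mathbf U_{t-m}(\mathbf s_t))$, $m\in\mathbb N_0$ fixed, $\mathbf H=(H_1,\dots,H_d):\mathbb R^{d\times(m+1)}\to\mathbb R^d$; the $\nu$th coordinate of $\mathbf U_t(\mathbf s)$ is $\sum_{\ell=1}^L\phi_{\nu\ell}d(\mathbf s,\mathbf r_\ell)F_t^{(\ell,\nu)}+E_t^{(\nu)}$ with fixed $L$, real $\phi_{\nu\ell}$, sites $\mathbf r_\ell\in[0,1]^q$, a function $d:[0,1]^q\times[0,1]^q\to[0,1]$, $\mathbf F_t^{(\ell)}=\sum_{j\ge0}\mathbb C_j^{(\ell)}\boldsymbol\varepsilon_{t-j}^{(\ell)}$, $\mathbf E_t=\sum_{j\ge0}\mathbb C_j^{(0)}\boldsymbol\varepsilon_{t-j}^{(0)}$, $d\times d$ matrices $\mathbb C_j^{(\ell)}$ with rows $\mathbf c_j^{(\ell,\nu)\top}$; $\varepsilon_t^{(\ell,\nu)}$ is the $\nu$th coordinate of $\boldsymbol\varepsilon_t^{(\ell)}$. (E1) $\{\boldsymbol\varepsilon_t^{(\ell)}\}_t$, $\ell=0,\dots,L$, mutually independent sequences of independent mean zero vectors $\boldsymbol\varepsilon_t^{(\ell)}=\Sigma_{\varepsilon,t}^{(\ell)1/2}\mathbf u_t^{(\ell)}$, $\Sigma_{\varepsilon,t}^{(\ell)}$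 symmetric positive definite, $\mathbf u_t^{(\ell)}$ mean zero with independent coordinates. (E2) $\sup_t\max_\ell\max_\nu\mathbb E|\varepsilon_t^{(\ell,\nu)}|^{2+\delta}<\infty$ for some $\delta>0$. (E3) If $d=1$: $\sup_t\max_\ell\mathbb E(\varepsilon_t^{(\ell)})^2<\infty$. (E4) If $d=1$: $\mathbb E(\varepsilon_t^{(0)})^2\ge\underline\sigma_0^2>0$; if $d>1$: $\lambda_{\min}(\Sigma_{\varepsilon,t}^{(0)})\ge\underline\lambda>0$. (E5) $\varepsilon_t^{(\ell,\nu)}$ has density $p_t^{(\ell,\nu)}$ with $\sup_t\int|p_t^{(\ell,\nu)}(z+x)-p_t^{(\ell,\nu)}(z)|dz=O(|x|)$. (E7) each $H_\nu$ is $L_H$-Lipschitz w.r.t. the Frobenius norm, and some random $d\times(m+1)$ matrix $\Xi$ independent of $\{\mathbf U_t\}$ has $\sup_\nu\mathbb E|H_\nu(\Xi)|^{2+\delta}<\infty$. *)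

(* Defs.v *)
From HB Require Import structures.
From mathcomp Require Import all_boot all_order all_algebra.
From mathcomp Require Import all_classical all_reals all_analysis.
Set Implicit Arguments. Unset Strict Implicit. Unset Printing Implicit Defensive.
Import Order.TTheory GRing.Theory Num.Theory.
Import numFieldNormedType.Exports.
Local Open Scope classical_set_scope.
Local Open Scope ring_scope.

Definition norm2 {R : realType} {n : nat} (v : 'cV[R]_n) : R :=
  Num.sqrt (\sum_(i < n) v i 0 ^+ 2).

Definition frob {R : realType} {m n : nat} (A : 'M[R]_(m, n)) : R :=
  Num.sqrt (\sum_(i < m) \sum_(j < n) A i j ^+ 2).

Definition spec_norm_le {R : realType} {n : nat} (M : 'M[R]_n) (K : R) : Prop :=
  forall v : 'cV[R]_n, norm2 (M *m v) <= K * norm2 v.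

Definition symmetric_mx {R : realType} {n : nat} (M : 'M[R]_n) : Prop := M^T = M.

Definition posdef {R : realType} {n : nat} (M : 'M[R]_n) : Prop :=
  symmetric_mx M /\ forall v : 'cV[R]_n, v != 0 -> 0 < (v^T *m M *m v) 0 0.

Definition mutually_indep_vecs {dsp} {T : measurableType dsp} {R : realType}
  (P : probability T R) {I : Type} {k : nat} (X : I -> 'I_k -> T -> R) : Prop :=
  forall (n : nat) (f : 'I_n -> I), injective f ->
  forall B : 'I_n -> 'I_k -> set R, (forall i j, measurable (B i j)) ->
  P (\bigcap_(i in [set: 'I_n]) \bigcap_(j in [set: 'I_k]) (X (f i) j @^-1` B i j))
  = (\prod_(i < n) P (\bigcap_(j in [set: 'I_k]) (X (f i) j @^-1` B i j)))%E.

Definition indep_coords {dsp} {T : measurableType dsp} {R : realType}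
  (P : probability T R) {k : nat} (X : 'I_k -> T -> R) : Prop :=
  forall B : 'I_k -> set R, (forall j, measurable (B j)) ->
  P (\bigcap_(j in [set: 'I_k]) (X j @^-1` B j)) = (\prod_(j < k) P (X j @^-1` B j))%E.

Definition indep_of_family {dsp} {T : measurableType dsp} {R : realType}
  (P : probability T R) {K : finType} {I : Type} (X : K -> T -> R) (Y : I -> T -> R) : Prop :=
  forall (B : K -> set R), (forall k, measurable (B k)) ->
  forall (n : nat) (f : 'I_n -> I) (C : 'I_n -> set R), (forall i, measurable (C i)) ->
  P ((\bigcap_(k in [set: K]) (X k @^-1` B k)) `&` (\bigcap_(i in [set: 'I_n]) (Y (f i) @^-1` C i)))
  = (P (\bigcap_(k in [set: K]) (X k @^-1` B k)) * P (\bigcap_(i in [set: 'I_n]) (Y (f i) @^-1` C i)))%E.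

Section model.
Context {dsp} {T : measurableType dsp} {R : realType} (P : probability T R).
Context (d q m L : nat).
(* innovations eps ℓ t ν, ℓ = 0..L, t : int, ν : coordinate *)
Context (eps : 'I_L.+1 -> int -> 'I_d -> T -> R).
(* coefficient matrices C j ℓ (d x d); rows are c_j^(ℓ,ν) *)
Context (C : nat -> 'I_L.+1 -> 'M[R]_d).

(* F_t^(ℓ) = sum_{j>=0} C_j^(ℓ) eps_{t-j}^(ℓ) (pointwise limit of partial sums);
   ℓ = 0 gives E_t *)
Definition MAproc (l : 'I_L.+1) (t : int) (nu : 'I_d) (w : T) : R :=
  limn (fun N : nat => \sum_(j < N) \sum_(k < d) C j l nu k * eps l (t - j%:Z) k w).

Context (phi : 'I_d -> 'I_L -> R) (r : 'I_L -> ('I_q -> R))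
        (dist : ('I_q -> R) -> ('I_q -> R) -> R).

Definition Ufield (t : int) (s : 'I_q -> R) (nu : 'I_d) (w : T) : R :=
  \sum_(l < L) phi nu l * dist s (r l) * MAproc (lift ord0 l) t nu w
  + MAproc ord0 t nu w.

Context (H : 'I_d -> 'M[R]_(d, m.+1) -> R) (s : nat -> ('I_q -> R)).

Definition Umat (t : nat) (w : T) : 'M[R]_(d, m.+1) :=
  \matrix_(i < d, k < m.+1) Ufield (t%:Z - k%:Z) (s t) i w.

Definition errobs (t : nat) (nu : 'I_d) (w : T) : R :=
  H nu (Umat t w) - fine ('E_P[fun w' => H nu (Umat t w')])%E.

End model.

Definition ols {R : realType} {n p : nat} (X : 'M[R]_(n, p)) (Y : 'cV[R]_n) : 'cV[R]_p :=
  invmx (X^T *m X) *m X^T *m Y.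

(* Main.v *)
Require Import Defs.
From HB Require Import structures.
From mathcomp Require Import all_boot all_order all_algebra.
From mathcomp Require Import all_classical all_reals all_analysis.
From mathcomp Require Import measurable_realfun ring lra zify complex.
Import Order.TTheory GRing.Theory Num.Theory.
Import numFieldNormedType.Exports.
Local Open Scope classical_set_scope.
Local Open Scope ring_scope.
Local Open Scope sesquilinear_scope.

(* Second moment method. The estimation error is [(X^T X)^-1 X^T err], and the
   eigenvalue bound makes [X^T X] coercive with constant [a T]; hence its
   squared norm is at most [(a T)^-2 |X^T err|^2], whose mean is governed by the
   covariances of the errors. Truncating the moving averages at lag [n] changes
   [H (U_t)] by [O(rho^n)] in [L^2], and truncated errors at distance at least
   [n + m] are independent, so the covariances decay geometrically in [|s - t|].
   The mean squared error is therefore [O(p / T)], and Markov's inequality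
   concludes. *)

Set Implicit Arguments.
Unset Strict Implicit.
Unset Printing Implicit Defensive.

(** * Quadratic forms and least squares *)

Lemma dot_mxE (R : pzSemiRingType) n (v w : 'cV[R]_n) :
  (v^T *m w) 0 0 = \sum_i v i 0 * w i 0.
Proof. by rewrite mxE; apply: eq_bigr => i _; rewrite mxE. Qed.

Lemma dot_diag_mxE (R : pzSemiRingType) n (d : 'rV[R]_n) (v w : 'cV[R]_n) :
  (v^T *m diag_mx d *m w) 0 0 = \sum_i v i 0 * d 0 i * w i 0.
Proof.
by rewrite -mulmxA mul_diag_mx dot_mxE; apply: eq_bigr => i _; rewrite mxE mulrA.
Qed.

Lemma eigenvalue_spectral_diag (C : numClosedFieldType) n (A : 'M[C]_n) i :
  A \is normalmx -> eigenvalue A (spectral_diag A 0 i).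
Proof.
move=> /orthomx_spectralP AE; have uQ := spectral_unit A.
apply/eigenvalueP; exists (row i (spectralmx A)).
  rewrite {2}AE !mulmxA -row_mul mulmxV// -row_mul mul1mx.
  by rewrite rowE -rowE row_diag_mx -scalemxAl -rowE.
apply: contraTneq (uQ) => Qi0; rewrite -row_free_unit.
by apply/row_freePn; exists i; rewrite Qi0 sub0mx.
Qed.

Lemma normalmx_quad_form_ge (C : numClosedFieldType) n (A : 'M[C]_n) (a : C) :
  A \is normalmx -> (forall i, a <= spectral_diag A 0 i) ->
  forall v : 'cV_n, a * (v ^t* *m v) 0 0 <= (v ^t* *m A *m v) 0 0.
Proof.
move=> nA a_le v; have /orthomx_spectralP AE := nA.
pose Q := spectralmx A; have uQ : Q \is unitarymx := spectral_unitarymx A.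
pose w := Q *m v.
have wE : w ^t* = v ^t* *m invmx Q by rewrite invmx_unitary// trmx_mul map_mxM.
have -> : v ^t* *m v = w ^t* *m w.
  by rewrite wE mulmxA mulmxKV// unitarymx_unit.
have -> : v ^t* *m A *m v = w ^t* *m diag_mx (spectral_diag A) *m w.
  by rewrite wE {1}AE !mulmxA.
rewrite -[w ^t*]map_trmx dot_mxE dot_diag_mxE mulr_sumr; apply: ler_sum => i _.
rewrite [leRHS]mulrAC [leRHS]mulrC ler_wpM2r//.
by rewrite mxE mulrC mul_conjC_ge0.
Qed.

Lemma symmetric_quad_form_ge (R : rcfType) n (S : 'M[R]_n) (a : R) :
  S^T = S -> (forall l, eigenvalue S l -> a <= l) ->
  forall v : 'cV_n, a * (v^T *m v) 0 0 <= (v^T *m S *m v) 0 0.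
Proof.
move=> symS a_le v; pose toC : {rmorphism R -> R[i]} := real_complex R.
have conj_real m k (A : 'M[R]_(m, k)) : map_mx Num.conj (map_mx toC A) = map_mx toC A.
  by apply/matrixP => i j; rewrite !mxE; exact: conjc_real.
have hermS : map_mx toC S \is hermsymmx.
  by apply/is_hermitianmxP; rewrite scale1r map_trmx conj_real symS.
have normalS := hermitian_normalmx hermS.
have a_le_diag i : toC a <= spectral_diag (map_mx toC S) 0 i.
  have /mxOverP/(_ 0 i)/complex_realP[l diagE] := hermitian_spectral_diag_real hermS.
  have := eigenvalue_spectral_diag i normalS.
  by rewrite diagE eigenvalue_map => /a_le; rewrite lecR.
have := normalmx_quad_form_ge normalS a_le_diag (map_mx toC v).
by rewrite map_trmx conj_real -!map_mxM !mxE -rmorphM lecR.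
Qed.

Lemma dot_mx_ge0 (R : realDomainType) n (v : 'cV[R]_n) : 0 <= (v^T *m v) 0 0.
Proof. by rewrite dot_mxE sumr_ge0// => i _; rewrite -expr2 sqr_ge0. Qed.

Lemma dot_mx_eq0 (R : realDomainType) n (v : 'cV[R]_n) :
  ((v^T *m v) 0 0 == 0) = (v == 0).
Proof.
apply/eqP/eqP => [|->]; last by rewrite mulmx0 mxE.
rewrite dot_mxE => /psumr_eq0P v0; apply/colP => i; rewrite mxE.
by apply/eqP; rewrite -sqrf_eq0 expr2 v0// => j _; rewrite -expr2 sqr_ge0.
Qed.

Lemma norm2_sqr (R : realType) n (v : 'cV[R]_n) :
  norm2 v ^+ 2 = (v^T *m v) 0 0.
Proof. by rewrite dot_mxE sqr_sqrtr// sumr_ge0// => i _; rewrite sqr_ge0. Qed.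

Lemma coercive_unitmx (R : realFieldType) n (G : 'M[R]_n) (k : R) : 0 < k ->
  (forall v : 'cV_n, k * (v^T *m v) 0 0 <= (v^T *m G *m v) 0 0) -> G \in unitmx.
Proof.
move=> k0 coercG; rewrite -row_free_unit; apply: inj_row_free => u uG0.
have := coercG u^T; rewrite trmxK uG0 mul0mx [leRHS]mxE pmulr_rle0// => uu_le0.
have : (u^T^T *m u^T) 0 0 == 0 by rewrite eq_le dot_mx_ge0 trmxK uu_le0.
by rewrite dot_mx_eq0 => /eqP /(congr1 trmx); rewrite trmxK trmx0.
Qed.

Lemma coercive_norm2_le (R : realType) n (G : 'M[R]_n) (k : R) : 0 <= k ->
  (forall v : 'cV_n, k * (v^T *m v) 0 0 <= (v^T *m G *m v) 0 0) ->
  forall v : 'cV_n, k * norm2 v <= norm2 (G *m v).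
Proof.
move=> k0 coercG v; rewrite -(@ler_pXn2r _ 2) ?nnegrE ?mulr_ge0 ?sqrtr_ge0//.
rewrite exprMn !norm2_sqr; set z := G *m v.
have := dot_mx_ge0 (z - k *: v).
have -> : ((z - k *: v)^T *m (z - k *: v)) 0 0 =
    (z^T *m z) 0 0 - 2 * k * (v^T *m z) 0 0 + k ^+ 2 * (v^T *m v) 0 0.
  rewrite !dot_mxE !mulr_sumr -sumrB -big_split /=.
  by apply: eq_bigr => i _; rewrite !mxE; ring.
have := ler_wpM2l k0 (coercG v); rewrite -mulmxA -/z.
by move: (_ 0 0) (_ 0 0) (_ 0 0) => *; lra.
Qed.

Lemma ols_subE (R : realType) (T p : nat) (X : 'M[R]_(T, p)) (b : 'cV[R]_p)
    (e : 'cV[R]_T) : X^T *m X \in unitmx ->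
  ols X (X *m b + e) - b = invmx (X^T *m X) *m (X^T *m e).
Proof.
by move=> uG; rewrite /ols mulmxDr -!mulmxA [X^T *m (X *m b)]mulmxA mulKmx// addrC addKr.
Qed.

Lemma ols_error_le (R : realType) (T p : nat) (X : 'M[R]_(T, p))
    (b : 'cV[R]_p) (e : 'cV[R]_T) (k : R) : 0 < k ->
  (forall l, eigenvalue (X^T *m X) l -> k <= l) ->
  k * norm2 (ols X (X *m b + e) - b) <= norm2 (X^T *m e).
Proof.
move=> k0 k_le; have symG : (X^T *m X)^T = X^T *m X by rewrite trmx_mul trmxK.
have coercG := symmetric_quad_form_ge symG k_le.
have uG := coercive_unitmx k0 coercG.
by rewrite ols_subE// (le_trans (coercive_norm2_le (ltW k0) coercG _))// mulKVmx.
Qed.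

(** * Measurability of limits and Lipschitz images *)

Lemma is_cvgn_limn_esup_einf (R : realType) (u : R^nat) :
  cvgn u <-> limn_esup (EFin \o u) = limn_einf (EFin \o u) /\
             limn_esup (EFin \o u) \is a fin_num.
Proof.
split=> [/cvg_ex[l ul]|[supinf sup_fin]].
  have uE : (EFin \o u) @ \oo --> l%:E by apply: cvg_EFin => //; exact: nearW.
  by have [-> ->] := cvg_limn_einf_sup uE.
apply/cvg_ex; exists (fine (limn_esup (EFin \o u))).
have u_sup n : (EFin (u n) <= esups (EFin \o u) n)%E.
  by apply: ereal_sup_ubound; exists n => /=.
have inf_u n : (einfs (EFin \o u) n <= EFin (u n))%E.
  by apply: ereal_inf_lbound; exists n => /=.
suff : EFin \o u @ \oo --> (fine (limn_esup (EFin \o u)))%:E by move/fine_cvg.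
rewrite fineK//.
apply: (@squeeze_cvge _ _ _ _ (einfs (EFin \o u)) _ (esups (EFin \o u))).
- by apply: nearW => n; rewrite inf_u u_sup.
- by rewrite supinf limn_einf_lim; exact: is_cvg_einfs.
- by rewrite limn_esup_lim; exact: is_cvg_esups.
Qed.

Lemma measurable_fun_limn_einf d (T : measurableType d) (R : realType)
    (h : (T -> \bar R)^nat) : (forall n, measurable_fun setT (h n)) ->
  measurable_fun setT (fun x => limn_einf (h ^~ x)).
Proof.
move=> mh; have -> : (fun x => limn_einf (h ^~ x)) =
    -%E \o (fun x => limn_esup ((fun n => -%E \o h n) ^~ x)).
  by apply/funext => x; rewrite /= -[LHS]oppeK -limn_esupN.
apply: measurableT_comp => //; apply: measurable_fun_limn_esup => n.
exact: (measurableT_comp _ (mh n)).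
Qed.

Lemma measurable_is_cvgn d (T : measurableType d) (R : realType) (h : (T -> R)^nat) :
  (forall n, measurable_fun setT (h n)) -> measurable [set x | cvgn (h ^~ x)].
Proof.
move=> mh; pose hE n := EFin \o h n.
have mhE n : measurable_fun setT (hE n) by exact/measurable_EFinP.
have msup := measurable_fun_limn_esup mhE.
have minf := measurable_fun_limn_einf mhE.
have -> : [set x | cvgn (h ^~ x)] =
    [set x | limn_esup (hE ^~ x) = limn_einf (hE ^~ x)] `&`
    [set x | limn_esup (hE ^~ x) \is a fin_num].
  by apply/seteqP; split=> x /is_cvgn_limn_esup_einf.
apply: measurableI; rewrite -[X in measurable X]setTI.
  exact: measurable_eqe.
exact: emeasurable_fin_num.
Qed.

Lemma measurable_fun_limn d (T : measurableType d) (R : realType) (h : (T -> R)^nat) :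
  (forall n, measurable_fun setT (h n)) ->
  measurable_fun setT (fun x => limn (h ^~ x)).
Proof.
move=> mh; pose D := [set x | cvgn (h ^~ x)].
have mD : measurable D := measurable_is_cvgn mh.
apply: (measurable_fun_cvg (h := fun n x => h n x * \1_D x)).
  by move=> n; apply: measurable_funM => //; exact: measurable_indic.
move=> x _; rewrite indicE; have [|] := boolP (x \in D).
  by rewrite inE => hx; under eq_fun do rewrite mulr1.
rewrite notin_setE => /dvgP ->; under eq_fun do rewrite mulr0.
exact: cvg_cst.
Qed.

(* [h (A w)] is the supremum over [k] of [h (q k) - K * dist (A w) (q k)]. *)
Lemma measurable_fun_lipschitz_dense d (T : measurableType d) (R : realType)
    (V : Type) (dist : V -> V -> R) (q : nat -> V) (K : R) (h : V -> R) (A : T -> V) :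
  0 <= K -> (forall x y, `|h x - h y| <= K * dist x y) ->
  (forall x e, 0 < e -> exists k, dist x (q k) < e) ->
  (forall k, measurable_fun setT (fun w => dist (A w) (q k))) ->
  measurable_fun setT (h \o A).
Proof.
move=> K0 h_lip q_dense mdist; pose f k w := h (q k) - K * dist (A w) (q k).
have f_le k w : f k w <= h (A w).
  have := h_lip (A w) (q k); rewrite distrC lerBlDr => /(le_trans (ler_norm _)).
  by rewrite lerBlDr addrC.
have f_ub w : has_ubound (range (f ^~ w)) by exists (h (A w)) => _ [k _ <-].
have -> : h \o A = (fun w => sups (f ^~ w) 0).
  apply/funext => w; apply/eqP; rewrite eq_le; apply/andP; split; last first.
    by apply: ge_sup; [exists (f 0%N w), 0%N|move=> _ [k _ <-]].
  apply/ler_addgt0Pr => e e0.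
  have e'_gt0 : 0 < e / (2 * K + 1) by rewrite divr_gt0//; lra.
  have [k dist_lt] := q_dense (A w) _ e'_gt0.
  have : f k w <= sups (f ^~ w) 0.
    by apply: ub_le_sup; [exact: has_ubound_sdrop|exists k].
  have /(le_trans (ler_norm _)) := h_lip (A w) (q k).
  move: dist_lt; rewrite ltr_pdivlMr /f /=; last by lra.
  move: (dist _ _) (sups _ _) (h _) (h _) => *; nra.
apply: measurable_fun_sups => // k; apply: measurable_funB => //.
exact: measurable_funM.
Qed.

Lemma frob_le_sum_norm (R : realType) m n (A : 'M[R]_(m, n)) :
  frob A <= \sum_i \sum_j `|A i j|.
Proof.
have norm_ge0 : 0 <= \sum_i \sum_j `|A i j| by do 2 apply: sumr_ge0 => ? _.
rewrite -[leRHS](ger0_norm norm_ge0) -sqrtr_sqr ler_wsqrtr//.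
rewrite !pair_bigA expr2 mulr_suml /=; apply: ler_sum => -[i j] _ /=.
rewrite -real_normK ?num_real// expr2 ler_wpM2l//.
by rewrite (bigD1 (i, j))//= lerDl sumr_ge0.
Qed.

Lemma rat_mx_dense (R : realType) m n (A : 'M[R]_(m, n)) (e : R) : 0 < e ->
  exists Q : 'M[rat]_(m, n), frob (A - map_mx ratr Q) < e.
Proof.
move=> e0; pose e' := e / (m * n).+1%:R.
have e'0 : 0 < e' by rewrite divr_gt0.
have near_rat i j : exists r : rat, `|A i j - ratr r| <= e'.
  have /rat_in_itvoo[r] : A i j - e' < A i j + e' by lra.
  by rewrite in_itv /= => /andP[? ?]; exists r; rewrite ler_norml; apply/andP; split; lra.
exists (\matrix_(i, j) projT1 (cid (near_rat i j))).
apply: le_lt_trans (frob_le_sum_norm _) _.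
apply: (@le_lt_trans _ _ (\sum_(i < m) \sum_(j < n) e')).
  by apply: ler_sum => i _; apply: ler_sum => j _; rewrite !mxE; case: cid.
rewrite !sumr_const !card_ord -mulrnA mulnC -mulr_natr /e' mulrAC ltr_pdivrMr//.
by rewrite ltr_pM2l// ltr_nat.
Qed.

Lemma measurable_fun_frob d (T : measurableType d) (R : realType) m n
    (A : T -> 'M[R]_(m, n)) :
  (forall i j, measurable_fun setT (fun w => A w i j)) ->
  measurable_fun setT (fun w => frob (A w)).
Proof.
move=> mA; apply: measurableT_comp.
  by apply: continuous_measurable_fun; exact: sqrt_continuous.
by apply: measurable_sum => i; apply: measurable_sum => j; exact: measurable_funX.
Qed.

Lemma measurable_fun_lipschitz_mx d (T : measurableType d) (R : realType) m n
    (h : 'M[R]_(m, n) -> R) (K : R) (A : T -> 'M[R]_(m, n)) : 0 <= K ->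
  (forall B B', `|h B - h B'| <= K * frob (B - B')) ->
  (forall i j, measurable_fun setT (fun w => A w i j)) ->
  measurable_fun setT (fun w => h (A w)).
Proof.
move=> K0 h_lip mA.
pose q k : 'M[R]_(m, n) := map_mx ratr (odflt (0 : 'M[rat]_(m, n)) (unpickle k)).
apply: (measurable_fun_lipschitz_dense (q := q) K0 h_lip) => [B e e0|k].
  by have [Q BQ] := rat_mx_dense B e0; exists (pickle Q); rewrite /q pickleK.
apply: measurable_fun_frob => i j; under eq_fun do rewrite mxE [X in _ + X]mxE.
exact: measurable_funB.
Qed.

Lemma measurable_fun_norm2 d (T : measurableType d) (R : realType) n (v : T -> 'cV[R]_n) :
  (forall i, measurable_fun setT (fun w => v w i 0)) ->
  measurable_fun setT (fun w => norm2 (v w)).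
Proof.
move=> mv; rewrite (_ : (fun w => _) = fun w => frob (v w)); last first.
  by apply/funext => w; congr Num.sqrt; apply: eq_bigr => i _; rewrite big_ord1.
by apply: measurable_fun_frob => i j; rewrite [j]ord1.
Qed.

Lemma measurable_fun_mulmxr d (T : measurableType d) (R : realType) m n
    (A : 'M[R]_(m, n)) (v : T -> 'cV[R]_n) :
  (forall i, measurable_fun setT (fun w => v w i 0)) ->
  forall i, measurable_fun setT (fun w => (A *m v w) i 0).
Proof.
move=> mv i; under eq_fun do rewrite mxE.
by apply: measurable_sum => j; exact: measurable_funM.
Qed.

(** * Minkowski's inequality for series *)

Lemma lee_poweR (R : realType) (r : R) (x y : \bar R) :
  0 <= r -> (0 <= x <= y)%E -> (x `^ r <= y `^ r)%E.
Proof.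
move=> r0 /andP[x0 xy]; apply: gt0_ler_poweR => //.
  by rewrite in_itv /= x0 leey.
by rewrite in_itv /= (le_trans x0 xy) leey.
Qed.

Lemma limn_poweR_ge (R : realType) (r : R) (u : (\bar R)^nat) : 0 < r ->
  (forall n, 0 <= u n)%E -> {homo u : m n / (m <= n)%N >-> (m <= n)%E} ->
  (limn u `^ r <= limn (fun n => u n `^ r))%E.
Proof.
move=> r0 u_ge0 ndu.
have ndur : {homo (fun n => u n `^ r)%E : m n / (m <= n)%N >-> (m <= n)%E}.
  by move=> m n mn; rewrite lee_poweR ?(ltW r0) ?u_ge0 ?ndu.
rewrite (cvg_lim _ (ereal_nondecreasing_cvgn ndu))//.
rewrite (cvg_lim _ (ereal_nondecreasing_cvgn ndur))//.
set s := (X in (_ <= X)%E).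
have ur_le n : (u n `^ r <= s)%E by apply: ereal_sup_ubound; exact: imageT.
have sup_le : (ereal_sup (range u) <= s `^ r^-1)%E.
  apply: ge_ereal_sup => _ [n _ <-].
  rewrite -[leLHS]poweRe1// -(mulfV (lt0r_neq0 r0)) poweRrM.
  by rewrite lee_poweR ?invr_ge0 ?(ltW r0) ?poweR_ge0/=.
have sup_ge0 : (0 <= ereal_sup (range u))%E.
  by apply: le_trans (u_ge0 0%N) _; apply: ereal_sup_ubound; exact: imageT.
have s_ge0 : (0 <= s)%E := le_trans (poweR_ge0 _ _) (ur_le 0%N).
apply: (@le_trans _ _ ((s `^ r^-1) `^ r)%E).
  by rewrite lee_poweR ?(ltW r0) ?sup_ge0 ?sup_le.
by rewrite -poweRrM mulVf ?lt0r_neq0// poweRe1.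
Qed.

Section Lnorm_inequalities.
Context d (T : measurableType d) (R : realType) (mu : {measure set T -> \bar R}).
Variable p : R.
Hypothesis p_ge1 : 1 <= p.
Local Open Scope ereal_scope.

Let p_gt0 : (0 < p)%R. Proof. exact: lt_le_trans p_ge1. Qed.
Let p_ge0 : (0 <= p)%R. Proof. exact: ltW. Qed.

Let measurable_abse_poweR (f : T -> \bar R) : measurable_fun setT f ->
  measurable_fun setT (fun x => `|f x| `^ p).
Proof.
by move=> mf; apply: (measurableT_comp (measurable_poweR _)); exact: measurableT_comp.
Qed.

Lemma le_Lnorm (f g : T -> \bar R) :
  measurable_fun setT f -> measurable_fun setT g ->
  (forall x, `|f x| <= `|g x|) -> 'N[mu]_p%:E[f] <= 'N[mu]_p%:E[g].
Proof.
move=> mf mg fg; rewrite unlock lee_poweR ?invr_ge0//.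
rewrite integral_ge0 => [/=|x _]; last exact: poweR_ge0.
apply: ge0_le_integral => //.
- by move=> x _; exact: poweR_ge0.
- exact: measurable_abse_poweR.
- exact: measurable_abse_poweR.
- by move=> x _; rewrite lee_poweR ?abse_ge0 ?fg.
Qed.

Lemma LnormMl (c : R) (f : T -> R) : measurable_fun setT f ->
  'N[mu]_p%:E[EFin \o (fun x => c * f x)%R] = `|c|%:E * 'N[mu]_p%:E[EFin \o f].
Proof.
move=> mf; rewrite unlock /=.
under eq_integral do rewrite normrM powRM//.
under eq_integral do rewrite EFinM.
rewrite ge0_integralZl//; last first.
  by apply: (@measurable_abse_poweR (EFin \o f)); exact/measurable_EFinP.
rewrite poweRM ?integral_ge0//.
by rewrite poweR_EFin -powRrM mulfV ?lt0r_neq0// powRr1.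
Qed.

Lemma Lnorm_sum_le I (r : seq I) (f : I -> T -> R) :
  (forall i, measurable_fun setT (f i)) ->
  'N[mu]_p%:E[EFin \o (fun x => \sum_(i <- r) f i x)%R] <=
  \sum_(i <- r) 'N[mu]_p%:E[EFin \o f i].
Proof.
move=> mf; elim: r => [|i r IH].
  rewrite big_nil (eq_Lnorm _ _ (g := cst 0)) ?Lnorm0// ?gt_eqF//.
  by move=> x; rewrite /= big_nil.
rewrite big_cons; apply: le_trans (leeD2l _ IH).
have -> : EFin \o (fun x => \sum_(j <- i :: r) f j x)%R =
    EFin \o (f i \+ (fun x => \sum_(j <- r) f j x))%R.
  by apply/funext => x; rewrite /= big_cons.
by apply: minkowski => //; exact: measurable_sum.
Qed.

Lemma Lnorm_limn_le (B : \bar R) (f : (T -> \bar R)^nat) :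
  (forall n, measurable_fun setT (f n)) -> (forall n x, 0 <= f n x) ->
  (forall x, {homo (f ^~ x) : m n / (m <= n)%N >-> m <= n}) ->
  (forall n, 'N[mu]_p%:E[f n] <= B) -> 'N[mu]_p%:E[(fun x => limn (f ^~ x))] <= B.
Proof.
move=> mf f0 ndf fB.
have B0 : 0 <= B by apply: le_trans (fB 0%N); exact: Lnorm_ge0.
have limf_ge0 x : 0 <= limn (f ^~ x).
  by apply: lime_ge; [exact/ereal_nondecreasing_is_cvgn/ndf|exact: nearW].
suff int_le : \int[mu]_x (limn (f ^~ x) `^ p) <= B `^ p.
  rewrite unlock; under eq_integral do rewrite gee0_abs//.
  rewrite -[leRHS]poweRe1// -(mulfV (lt0r_neq0 p_gt0)) poweRrM.
  by rewrite lee_poweR ?invr_ge0// int_le integral_ge0// => x _; rewrite poweR_ge0.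
have mfp n : measurable_fun setT (fun x => f n x `^ p).
  exact: (measurableT_comp (measurable_poweR _) (mf n)).
have ndfp x : {homo (fun n => f n x `^ p) : m n / (m <= n)%N >-> m <= n}.
  by move=> m n mn; rewrite lee_poweR ?f0 ?ndf.
have mlim (u : (T -> \bar R)^nat) : (forall n, measurable_fun setT (u n)) ->
    (forall x, {homo (u ^~ x) : m n / (m <= n)%N >-> m <= n}) ->
    measurable_fun setT (fun x => limn (u ^~ x)).
  move=> meas_u ndu; apply: (emeasurable_fun_cvg u) => // x _.
  exact/ereal_nondecreasing_is_cvgn/ndu.
apply: (@le_trans _ _ (\int[mu]_x limn (fun n => f n x `^ p))).
  apply: ge0_le_integral => //.
  - by move=> x _; rewrite poweR_ge0.
  - exact: (measurableT_comp (measurable_poweR _) (mlim _ mf ndf)).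
  - exact: mlim.
  - by move=> x _; exact: limn_poweR_ge.
have fp_ge0 n x : setT x -> 0 <= f n x `^ p by rewrite poweR_ge0.
apply: (cvge_le _ (cvg_monotone_convergence measurableT mfp fp_ge0 _)) => //.
apply: nearW => n; apply: le_trans (_ : 'N[mu]_p%:E[f n] `^ p <= _).
  rewrite poweR_Lnorm ?lt0r_neq0//.
  by under [leRHS]eq_integral do rewrite gee0_abs//.
by rewrite lee_poweR ?Lnorm_ge0 ?fB.
Qed.

Lemma Lnorm_nneseries_le (f : (T -> R)^nat) m :
  (forall n, measurable_fun setT (f n)) ->
  'N[mu]_p%:E[(fun x => \sum_(m <= n <oo) `|f n x|%:E)] <=
  \sum_(m <= n <oo) 'N[mu]_p%:E[EFin \o f n].
Proof.
move=> mf; have mabs n : measurable_fun setT (fun x => `|f n x|%R).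
  exact: measurableT_comp.
apply: (@Lnorm_limn_le _ (fun n x => \sum_(m <= k < n) `|f k x|%:E)) => [n|n x|x|n].
- by apply: emeasurable_sum => k; exact/measurable_EFinP.
- exact: sume_ge0.
- by move=> k n kn; exact: lee_sum_nneg_natr.
rewrite (eq_Lnorm _ _ (g := EFin \o (fun x => \sum_(m <= k < n) `|f k x|)%R)); last first.
  by move=> x; rewrite /= sumEFin.
apply: le_trans (Lnorm_sum_le _ mabs) _.
rewrite (eq_bigr (fun k => 'N[mu]_p%:E[EFin \o f k])) => [|k _]; last first.
  exact: (Lnorm_abse _ (EFin \o f k)).
by apply: nneseries_lim_ge => k _ _; exact: Lnorm_ge0.
Qed.

End Lnorm_inequalities.

Lemma limn_sum_tail_le (R : realType) (a : R^nat) n :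
  (`|limn (fun N => \sum_(j < N) a j) - \sum_(j < n) a j|%:E <=
   \sum_(n <= j <oo) `|a j|%:E)%E.
Proof.
have -> : (fun N => \sum_(j < N) a j) = series a.
  by apply/funext => N; rewrite /series /= big_mkord.
rewrite -(big_mkord xpredT) -[X in _ - X]/(series a n).
have tail_ge k : ((\sum_(n <= j < k) `|a j|)%:E <= \sum_(n <= j <oo) `|a j|%:E)%E.
  by rewrite -sumEFin; apply: nneseries_lim_ge => j _ _; rewrite lee_fin.
move: tail_ge; case: (\sum_(n <= j <oo) _)%E => [V||] tail_ge; last 2 first.
- by rewrite leey.
- by have := tail_ge n; rewrite leNgt ltNye.
rewrite lee_fin; have {}tail_ge k : \sum_(n <= j < k) `|a j| <= V by rewrite -lee_fin.
have cvg_a : cvgn (series a).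
  have nd_norm : nondecreasing_seq [normed series a].
    by apply: nondecreasing_series => ? _ _; exact: normr_ge0.
  apply: normed_cvg; apply: nondecreasing_is_cvgn => //.
  exists (\sum_(0 <= j < n) `|a j| + V) => _ [N _ <-].
  apply: le_trans (nd_norm _ _ (leq_addl n N)) _.
  by rewrite /normed_series_of /series /= (big_cat_nat _ (leq_addr N n))// lerD2l.
have cvg_tail : `|series a N - series a n| @[N --> \oo] --> `|limn (series a) - series a n|.
  by apply: cvg_norm; apply: cvgB => //; exact: cvg_cst.
rewrite -(cvg_lim _ cvg_tail)//; apply: limr_le; first exact: cvgP cvg_tail.
exists n => // N /= nN; rewrite sub_series_geq//.
exact: le_trans (ler_norm_sum _ _ _) (tail_ge N).
Qed.

Lemma nneseries_geometric (R : realType) (c rho : R) n : 0 <= c -> 0 <= rho < 1 ->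
  (\sum_(n <= j <oo) (c * rho ^+ j)%:E = (c * rho ^+ n / (1 - rho))%:E)%E.
Proof.
move=> c0 /andP[r0 r1]; rewrite -nneseries_addn; last first.
  by move=> j; rewrite lee_fin mulr_ge0 ?exprn_ge0.
apply/cvg_lim => //.
rewrite (_ : (fun _ => _) = EFin \o series (geometric (c * rho ^+ n) rho)).
  apply: cvg_EFin; first exact: nearW.
  by apply: cvg_geometric_series; rewrite ger0_norm.
apply/funext => N; rewrite /series /= -sumEFin; apply: eq_bigr => j _.
by rewrite addnC exprD mulrA.
Qed.

Lemma Lnorm_limn_sum_tail_le d (T : measurableType d) (R : realType)
    (mu : {measure set T -> \bar R}) (p : R) (a : (T -> R)^nat) n : 1 <= p ->
  (forall j, measurable_fun setT (a j)) ->
  ('N[mu]_p%:E[EFin \o (fun x => limn (fun N => \sum_(j < N) a j x)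
                                 - \sum_(j < n) a j x)%R] <=
   \sum_(n <= j <oo) 'N[mu]_p%:E[EFin \o a j])%E.
Proof.
move=> p_ge1 ma; apply: le_trans (Lnorm_nneseries_le mu p_ge1 n ma).
apply: le_Lnorm => // [||x].
- apply/measurable_EFinP; apply: measurable_funB; last exact: measurable_sum.
  by apply: measurable_fun_limn => N; exact: measurable_sum.
- apply: (emeasurable_fun_cvg (fun N x => \sum_(n <= j < N) `|a j x|%:E)%E) => [N|x _].
    by apply: emeasurable_sum => j; apply/measurable_EFinP; exact: measurableT_comp.
  by apply: is_cvg_nneseries => j _ _; rewrite lee_fin.
rewrite [leRHS]gee0_abs; first exact: limn_sum_tail_le.
by apply: nneseries_ge0 => j _ _; rewrite lee_fin.
Qed.

Lemma Lnorm_lipschitz_mx_le d (T : measurableType d) (R : realType)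
    (mu : {measure set T -> \bar R}) (p : R) m n (h : 'M[R]_(m, n) -> R) (K : R)
    (A B : T -> 'M[R]_(m, n)) : 1 <= p -> 0 <= K ->
  (forall M N, `|h M - h N| <= K * frob (M - N)) ->
  (forall i j, measurable_fun setT (fun x => A x i j)) ->
  (forall i j, measurable_fun setT (fun x => B x i j)) ->
  ('N[mu]_p%:E[EFin \o (fun x => h (A x) - h (B x))%R] <=
   K%:E * \sum_i \sum_j 'N[mu]_p%:E[EFin \o (fun x => A x i j - B x i j)%R])%E.
Proof.
move=> p_ge1 K0 h_lip mA mB; pose D i j x := A x i j - B x i j.
have mD i j : measurable_fun setT (fun x => `|D i j x|).
  by apply: measurableT_comp => //; exact: measurable_funB.
have mDi i : measurable_fun setT (fun x => \sum_j `|D i j x|) by exact: measurable_sum.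
have mDs : measurable_fun setT (fun x => \sum_i \sum_j `|D i j x|) by exact: measurable_sum.
apply: (@le_trans _ _ 'N[mu]_p%:E[EFin \o (fun x => K * \sum_i \sum_j `|D i j x|)%R]%E).
  apply: le_Lnorm => //.
  - apply/measurable_EFinP; apply: measurable_funB;
      exact: (measurable_fun_lipschitz_mx K0 h_lip).
  - by apply/measurable_EFinP; exact: measurable_funM.
  move=> x; rewrite lee_fin (le_trans (h_lip _ _))// (le_trans _ (ler_norm _))//.
  rewrite ler_wpM2l// (le_trans (frob_le_sum_norm _))//.
  by apply: ler_sum => i _; apply: ler_sum => j _; rewrite !mxE.
rewrite LnormMl// ger0_norm// lee_wpmul2l ?lee_fin//.
apply: le_trans (Lnorm_sum_le _ p_ge1 _ mDi) _; apply: lee_sum => i _.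
apply: le_trans (Lnorm_sum_le _ p_ge1 _ (mD i)) _; apply: lee_sum => j _.
by rewrite -(Lnorm_abse mu (EFin \o D i j)).
Qed.

Lemma Lnorm_le_moment d (T : measurableType d) (R : realType) (P : probability T R)
    (p q M : R) (f : T -> R) : 0 < p <= q -> measurable_fun setT f ->
  (\int[P]_w (`|f w| `^ q)%:E <= M%:E)%E ->
  ('N[P]_p%:E[EFin \o f] <= ((1 + M) `^ p^-1)%:E)%E.
Proof.
move=> /andP[p0 pq] mf fM.
have powR_le (x : R) : 0 <= x -> x `^ p <= 1 + x `^ q.
  move=> x0; have [x1|/ltW x1] := leP x 1.
    rewrite ler_wpDr ?powR_ge0//; have <- : 1 `^ p = 1 :> R by rewrite powR1.
    by apply: ge0_ler_powR; rewrite ?nnegrE ?(ltW p0).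
  by rewrite ler_wpDl// ler_powR.
have mpow (a : R) : measurable_fun setT (fun w => (`|f w| `^ a)%:E).
  apply/measurable_EFinP; apply: (measurableT_comp (measurable_powR _)).
  exact: measurableT_comp.
rewrite unlock -poweR_EFin lee_poweR ?invr_ge0 ?(ltW p0)//.
rewrite integral_ge0 => [/=|w _]; last by rewrite lee_fin powR_ge0.
apply: (@le_trans _ _ (\int[P]_w (1 + (`|f w| `^ q)%:E))%E).
  apply: ge0_le_integral => //.
  - by apply: emeasurable_funD => //; exact: mpow.
  - by move=> w _; rewrite -EFinD lee_fin powR_le.
rewrite ge0_integralD//.
by rewrite integral_cst//= probability_setT mule1 EFinD leeD2l.
Qed.

Lemma Lfun_Lnorm_le d (T : measurableType d) (R : realType)
    (mu : {measure set T -> \bar R}) (p : \bar R) (f : T -> R) (b : R) :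
  measurable_fun setT f -> ('N[mu]_p[EFin \o f] <= b%:E)%E -> f \in Lfun mu p.
Proof.
move=> mf fb; rewrite inE; apply/andP; split; rewrite inE //=.
exact: le_lt_trans fb (ltry b).
Qed.

(** * Independence *)

Section independence.
Context d (T : measurableType d) (R : realType) (P : probability T R).

Definition indep_systems (G1 G2 : set (set T)) :=
  forall A B, G1 A -> G2 B -> P (A `&` B) = (P A * P B)%E.

Lemma indep_systemsC G1 G2 : indep_systems G1 G2 -> indep_systems G2 G1.
Proof. by move=> ind A B GA GB; rewrite setIC muleC; exact: ind. Qed.

(* For fixed [B], the finite measures [A |-> P (A `&` B)] and
   [A |-> P A * P B] agree on the pi-system [G1]. *)
Lemma indep_systems_sigma G1 G2 : setI_closed G1 -> G1 setT ->
  G1 `<=` measurable -> G2 `<=` measurable ->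
  indep_systems G1 G2 -> indep_systems <<s G1 >> G2.
Proof.
move=> G1I G1T mG1 mG2 ind A B sG1A G2B; have mB := mG2 _ G2B.
pose pB : {nonneg R} := NngNum (fine_ge0 (measure_ge0 P B)).
have -> : P (A `&` B) = mrestr P mB A by [].
have scaleE C : (P C * P B = mscale pB P C)%E.
  by rewrite muleC /mscale /= fineK// fin_num_measure.
rewrite scaleE; apply: (@g_sigma_algebra_measure_unique _ _ _ G1 mG1 (fun=> setT)) => //.
- exact: bigcup_const.
- by move=> C G1C; rewrite [RHS]/= -scaleE; exact: ind.
- by move=> _; rewrite /= /mrestr ltey_eq fin_num_measure//; exact: measurableI.
Qed.

Lemma indep_systems_sigma2 G1 G2 : setI_closed G1 -> setI_closed G2 ->
  G1 setT -> G2 setT -> G1 `<=` measurable -> G2 `<=` measurable ->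
  indep_systems G1 G2 -> indep_systems <<s G1 >> <<s G2 >>.
Proof.
move=> G1I G2I G1T G2T mG1 mG2 ind; apply: indep_systemsC.
apply: indep_systems_sigma => //.
  by apply: smallest_sub mG1; exact: sigma_algebra_measurable.
by apply: indep_systemsC; exact: indep_systems_sigma.
Qed.

Definition indep_rv (Y Z : T -> R) := forall A B, measurable A -> measurable B ->
  P ((Y @^-1` A) `&` (Z @^-1` B)) = (P (Y @^-1` A) * P (Z @^-1` B))%E.

End independence.

Lemma integral_prod_mul d1 d2 (T1 : measurableType d1) (T2 : measurableType d2)
    (R : realType) (m1 : {sigma_finite_measure set T1 -> \bar R})
    (m2 : {sigma_finite_measure set T2 -> \bar R}) (f : T1 -> R) (g : T2 -> R) :
  m1.-integrable setT (EFin \o f) -> m2.-integrable setT (EFin \o g) ->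
  (m1 \x m2)%E.-integrable setT (fun z => (f z.1 * g z.2)%:E) ->
  (\int[m1 \x m2]_z (f z.1 * g z.2)%:E =
   \int[m1]_x (f x)%:E * \int[m2]_y (g y)%:E)%E.
Proof.
move=> intf intg intfg; rewrite -integral12_prod_meas1// /fubini_F /=.
under eq_integral do under eq_integral do rewrite EFinM.
under eq_integral do rewrite integralZl//.
by rewrite -(fineK (integrable_fin_num measurableT intg)) integralZr.
Qed.

Lemma integrable_distribution d d' (T : measurableType d) (T' : measurableType d')
    (R : realType) (P : probability T R) (X : {RV P >-> T'}) (f : T' -> \bar R) :
  measurable_fun setT f -> P.-integrable setT (f \o X) ->
  (distribution P X).-integrable setT f.
Proof.
move=> mf intfX.
have := integrable_pushforward (measurable_funPT X) (mu := P) (D := setT) mf.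
by rewrite preimage_setT; apply.
Qed.

Section independent_random_variables.
Context d (T : measurableType d) (R : realType) (P : probability T R).
Variables (Y Z : {RV P >-> R}).
Hypothesis ind : indep_rv P Y Z.

Let YZ : T -> R * R := fun w => (Y w, Z w).
Let measurable_YZ : measurable_fun setT YZ.
Proof. exact: measurable_fun_pair. Qed.
HB.instance Definition _ := isMeasurableFun.Build _ _ _ _ YZ measurable_YZ.

Lemma indep_rv_distribution_pair A : measurable A ->
  (distribution P Y \x distribution P Z)%E A = distribution P (YZ : {RV P >-> _}) A.
Proof.
by move=> mA; apply: product_measure_unique mA => B C mB mC; rewrite -ind.
Qed.

Let mul_coords (z : R * R) : \bar R := (z.1 * z.2)%:E.

Let measurable_mul_coords : measurable_fun setT mul_coords.
Proof. by apply/measurable_EFinP; exact: measurable_funM. Qed.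

Let integrable_product_law : P.-integrable setT (mul_coords \o YZ) ->
  (distribution P Y \x distribution P Z)%E.-integrable setT mul_coords.
Proof.
move=> intYZ; apply/integrableP; split => //.
rewrite (eq_measure_integral (distribution P (YZ : {RV P >-> _}))) => [|A mA _].
  by have /integrableP[] := integrable_distribution (X := YZ) measurable_mul_coords intYZ.
exact: indep_rv_distribution_pair.
Qed.

Lemma indep_rv_expectationM : (Y : T -> R) \in Lfun P 1 -> (Z : T -> R) \in Lfun P 1 ->
  (Y \* Z)%R \in Lfun P 1 -> ('E_P[(Y \* Z)%R] = 'E_P[Y] * 'E_P[Z])%E.
Proof.
move=> /Lfun1_integrable intY /Lfun1_integrable intZ /Lfun1_integrable intYZ.
rewrite unlock.
rewrite -(@integral_distribution _ _ _ _ _ P (YZ : {RV P >-> _}) mul_coords)//.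
rewrite -(eq_measure_integral _ (fun A mA _ => indep_rv_distribution_pair mA)).
have law_int (V : {RV P >-> R}) := integrable_distribution (X := V) (@EFin_measurable R setT).
rewrite (integral_prod_mul (law_int Y intY) (law_int Z intZ))//; last first.
  exact: integrable_product_law.
by rewrite !integral_distribution.
Qed.

End independent_random_variables.

Lemma indep_rv_covariance0 d (T : measurableType d) (R : realType)
    (P : probability T R) (Y Z : T -> R) : indep_rv P Y Z ->
  Y \in Lfun P 2%:E -> Z \in Lfun P 2%:E -> covariance P Y Z = 0%E.
Proof.
move=> ind Y2 Z2; have Pfin : P setT \is a fin_num by exact: fin_num_measure.
have YZ1 : (Y \* Z)%R \in Lfun P 1 by exact: Lfun2_mul_Lfun1.
have Y1 : Y \in Lfun P 1 by exact: Lfun_subset12.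
have Z1 : Z \in Lfun P 1 by exact: Lfun_subset12.
pose RVof (V : T -> R) (V2 : V \in Lfun P 2%:E) : {RV P >-> R} :=
  HB.pack V (isMeasurableFun.Build _ _ _ _ V (set_mem (sub_Lfun_mfun V2))).
rewrite covarianceE//.
rewrite [X in (X - _)%E](@indep_rv_expectationM _ _ _ _ (RVof Y Y2) (RVof Z Z2))//.
by rewrite subee// fin_numM ?expectation_fin_num.
Qed.

Section cylinders.
Context d (T : measurableType d) (R : realType) (P : probability T R).
Context (J : Type) (k : nat) (X : J -> 'I_k -> T -> R).

Definition cylinder n (f : 'I_n -> J) (B : 'I_n -> 'I_k -> set R) : set T :=
  \bigcap_(i in [set: 'I_n]) \bigcap_(j in [set: 'I_k]) (X (f i) j @^-1` B i j).

Definition cylinders n (f : 'I_n -> J) : set (set T) :=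
  [set A | exists2 B, (forall i j, measurable (B i j)) & A = cylinder f B].

Lemma setI_closed_cylinders n (f : 'I_n -> J) : setI_closed (cylinders f).
Proof.
move=> _ _ [B mB ->] [B' mB' ->].
exists (fun i j => B i j `&` B' i j); first by move=> i j; exact: measurableI.
apply/seteqP; split => [w [BX B'X] i _ j _|w BX].
  by split; [exact: BX|exact: B'X].
by split => i _ j _; have [] := BX i I j I.
Qed.

Lemma cylinders_setT n (f : 'I_n -> J) : cylinders f setT.
Proof. by exists (fun _ _ => setT) => //; apply/seteqP; split. Qed.

Lemma cylinders_measurable n (f : 'I_n -> J) :
  (forall i j, measurable_fun setT (X i j)) -> cylinders f `<=` measurable.
Proof.
move=> mX _ [B mB ->].
apply: fin_bigcap_measurable => // i _; apply: fin_bigcap_measurable => // j _.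
by rewrite -[X in measurable X]setTI; exact: mX.
Qed.

Lemma measurable_fun_cylinders n (f : 'I_n -> J) i j :
  measurable_fun (setT : set (g_sigma_algebraType (cylinders f))) (X (f i) j).
Proof.
move=> _ B mB; rewrite setTI; apply: sub_sigma_algebra.
exists (fun i' j' => if (i' == i) && (j' == j) then B else setT).
  by move=> i' j'; case: ifP.
apply/seteqP; split => [w Bw i' _ j' _|w BX] /=.
  by case: ifP => // /andP[/eqP -> /eqP ->].
by have := BX i I j I; rewrite /= !eqxx.
Qed.

Hypothesis ind : mutually_indep_vecs P X.

Lemma indep_cylinders n1 n2 (f1 : 'I_n1 -> J) (f2 : 'I_n2 -> J) :
  injective f1 -> injective f2 -> (forall i j, f1 i <> f2 j) ->
  indep_systems P (cylinders f1) (cylinders f2).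
Proof.
move=> inj1 inj2 f12 _ _ [B1 mB1 ->] [B2 mB2 ->].
pose glue U (g1 : 'I_n1 -> U) (g2 : 'I_n2 -> U) (i : 'I_(n1 + n2)) :=
  match fintype.split i with inl i1 => g1 i1 | inr i2 => g2 i2 end.
have gluel U g1 g2 i : @glue U g1 g2 (lshift n2 i) = g1 i.
  by rewrite /glue (unsplitK (inl i)).
have gluer U g1 g2 i : @glue U g1 g2 (rshift n1 i) = g2 i.
  by rewrite /glue (unsplitK (inr i)).
have inj12 : injective (glue _ f1 f2).
  move=> i j; case: (split_ordP i) => i' ->; case: (split_ordP j) => j' ->;
    rewrite ?gluel ?gluer.
  - by move/inj1 ->.
  - by move/f12.
  - by move/esym/f12.
  - by move/inj2 ->.
have mB12 i j : measurable (glue _ B1 B2 i j) by rewrite /glue; case: fintype.split.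
have := ind inj12 mB12; rewrite big_split_ord /=.
under eq_bigr do rewrite !gluel.
under [X in (_ * X)%E]eq_bigr do rewrite !gluer.
rewrite -(ind inj1 mB1) -(ind inj2 mB2) => <-; congr (P _).
apply/seteqP; split => [w [BX1 BX2] i _ j _|w BX].
  by case: (split_ordP i) => i' ->; rewrite !(gluel, gluer); [exact: BX1|exact: BX2].
split => i _ j _.
- by have := BX (lshift n2 i) I j I; rewrite /= !gluel.
- by have := BX (rshift n1 i) I j I; rewrite /= !gluer.
Qed.

Lemma indep_rv_cylinders n1 n2 (f1 : 'I_n1 -> J) (f2 : 'I_n2 -> J) (Y Z : T -> R) :
  (forall i j, measurable_fun setT (X i j)) ->
  injective f1 -> injective f2 -> (forall i j, f1 i <> f2 j) ->
  measurable_fun (setT : set (g_sigma_algebraType (cylinders f1))) Y ->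
  measurable_fun (setT : set (g_sigma_algebraType (cylinders f2))) Z ->
  indep_rv P Y Z.
Proof.
move=> mX inj1 inj2 f12 mY mZ A B mA mB.
apply: (@indep_systems_sigma2 _ _ _ P (cylinders f1) (cylinders f2)).
- exact: setI_closed_cylinders.
- exact: setI_closed_cylinders.
- exact: cylinders_setT.
- exact: cylinders_setT.
- exact: cylinders_measurable.
- exact: cylinders_measurable.
- exact: indep_cylinders.
- by have := mY measurableT _ mA; rewrite setTI.
- by have := mZ measurableT _ mB; rewrite setTI.
Qed.

End cylinders.

(** * Covariances *)

Section covariance_bounds.
Context d (T : measurableType d) (R : realType) (P : probability T R).

Let Lfun21 (X : T -> R) : X \in Lfun P 2%:E -> X \in Lfun P 1.
Proof. by apply: Lfun_subset12; exact: fin_num_measure. Qed.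

Lemma variance_le_Lnorm (X : T -> R) (b : R) : X \in Lfun P 2%:E ->
  ('N[P]_2%:E[EFin \o X] <= b%:E)%E -> ('V_P[X] <= (b ^+ 2)%:E)%E.
Proof.
move=> X2 Xb; rewrite varianceE//.
have -> : ('E_P[X ^+ 2] = 'N[P]_2%:E[EFin \o X] `^ 2)%E.
  rewrite poweR_Lnorm// unlock; apply: eq_integral => w _ /=.
  by rewrite powR_mulrn// real_normK// num_real.
have EX_fin : ('E_P[X])%E \is a fin_num.
  exact/expectation_fin_num/Lfun21.
rewrite leeBlDr; last by rewrite fin_numX.
rewrite -(fineK EX_fin) -EFin_expe -EFinD -powR_mulrn; last first.
  by rewrite -lee_fin; apply: le_trans Xb; exact: Lnorm_ge0.
apply: (@le_trans _ _ (b `^ 2)%:E); last by rewrite lee_fin lerDl sqr_ge0.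
by rewrite -poweR_EFin lee_poweR// Lnorm_ge0 Xb.
Qed.

Lemma covariance_fineK (X Y : T -> R) : X \in Lfun P 2%:E -> Y \in Lfun P 2%:E ->
  (fine (covariance P X Y))%:E = covariance P X Y.
Proof.
move=> X2 Y2; rewrite fineK//.
by apply: covariance_fin_num; [exact: Lfun21|exact: Lfun21|exact: Lfun2_mul_Lfun1].
Qed.

Lemma normr_covariance_le (X Y : T -> R) (x y : R) : 0 <= x -> 0 <= y ->
  X \in Lfun P 2%:E -> Y \in Lfun P 2%:E ->
  ('V_P[X] <= (x ^+ 2)%:E)%E -> ('V_P[Y] <= (y ^+ 2)%:E)%E ->
  `|fine (covariance P X Y)| <= x * y.
Proof.
move=> x0 y0 X2 Y2 VX VY.
have sd_le (v : \bar R) (u : R) : 0 <= u -> (v <= (u ^+ 2)%:E)%E -> (sqrte v <= u%:E)%E.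
  move=> u0 vu; have -> : u%:E = sqrte (u ^+ 2)%:E by rewrite /= sqrtr_sqr ger0_norm.
  by rewrite lee_sqrt// lee_fin sqr_ge0.
have cov_le (Z : T -> R) : Z \in Lfun P 2%:E -> ('V_P[Z] <= (x ^+ 2)%:E)%E ->
    fine (covariance P Z Y) <= x * y.
  move=> Z2 VZ; rewrite -lee_fin covariance_fineK// EFinM.
  by apply: le_trans (covariance_le Z2 Y2) _; rewrite lee_pmul ?sqrte_ge0 ?sd_le.
rewrite ler_norml cov_le// andbT lerNl.
have <- : fine (covariance P (\- X) Y) = - fine (covariance P X Y).
  by rewrite covarianceNl ?fineN//; [exact: Lfun21|exact: Lfun21|exact: Lfun2_mul_Lfun1].
by rewrite cov_le ?rpredN ?varianceN.
Qed.

Lemma fine_covarianceBl (X Y Z : T -> R) :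
  X \in Lfun P 2%:E -> Y \in Lfun P 2%:E -> Z \in Lfun P 2%:E ->
  fine (covariance P (X \- Y) Z) = fine (covariance P X Z) - fine (covariance P Y Z).
Proof.
move=> X2 Y2 Z2; rewrite covarianceBl//.
by rewrite -(covariance_fineK X2 Z2) -(covariance_fineK Y2 Z2).
Qed.

(* [cov X Y = cov (X - X') Y + cov X (Y - Y') - cov (X - X') (Y - Y')]
   when [cov X' Y' = 0]. *)
Lemma normr_covariance_approx_le (X Y X' Y' : T -> R) (x y e : R) :
  0 <= x -> 0 <= y -> 0 <= e <= 1 ->
  X \in Lfun P 2%:E -> Y \in Lfun P 2%:E -> X' \in Lfun P 2%:E -> Y' \in Lfun P 2%:E ->
  ('V_P[X] <= (x ^+ 2)%:E)%E -> ('V_P[Y] <= (y ^+ 2)%:E)%E ->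
  ('V_P[(X \- X')%R] <= ((x * e) ^+ 2)%:E)%E ->
  ('V_P[(Y \- Y')%R] <= ((y * e) ^+ 2)%:E)%E ->
  covariance P X' Y' = 0%E ->
  `|fine (covariance P X Y)| <= 3 * (x * y) * e.
Proof.
move=> x0 y0 /andP[e0 e1] X2 Y2 X'2 Y'2 VX VY VXX' VYY' cov0.
have XX'2 : (X \- X')%R \in Lfun P 2%:E by rewrite rpredB// lee1n.
have YY'2 : (Y \- Y')%R \in Lfun P 2%:E by rewrite rpredB// lee1n.
have cov_split : fine (covariance P X Y) = fine (covariance P (X \- X')%R Y) +
    fine (covariance P X (Y \- Y')%R) - fine (covariance P (X \- X')%R (Y \- Y')%R).
  rewrite !(fine_covarianceBl X2 X'2)// ![covariance P _ (Y \- Y')%R]covarianceC.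
  rewrite !(fine_covarianceBl Y2 Y'2)//.
  rewrite ![covariance P _ X]covarianceC ![covariance P _ X']covarianceC.
  by rewrite cov0 /=; ring.
have := normr_covariance_le (mulr_ge0 x0 e0) y0 XX'2 Y2 VXX' VY.
have := normr_covariance_le x0 (mulr_ge0 y0 e0) X2 YY'2 VX VYY'.
have := normr_covariance_le (mulr_ge0 x0 e0) (mulr_ge0 y0 e0) XX'2 YY'2 VXX' VYY'.
have xye : x * e * (y * e) <= x * y * e.
  by rewrite mulrACA mulrA ler_piMr// !mulr_ge0.
rewrite cov_split !ler_norml.
move: (fine _) (fine _) (fine _) => *.
by apply/andP; split; lra.
Qed.

Section geometric_decay.
Variables (X : nat -> T -> R) (Y : nat -> nat -> T -> R) (m : nat) (b rho : R).
Hypotheses (b0 : 0 <= b) (rho01 : 0 <= rho <= 1).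
Hypotheses (X2 : forall t, X t \in Lfun P 2%:E) (Y2 : forall n t, Y n t \in Lfun P 2%:E).
Hypothesis VX : forall t, ('V_P[X t] <= (b ^+ 2)%:E)%E.
Hypothesis VXY : forall n t, ('V_P[(X t \- Y n t)%R] <= ((b * rho ^+ n) ^+ 2)%:E)%E.
Hypothesis covY : forall n s t, (s + (n + m) <= t)%N -> covariance P (Y n s) (Y n t) = 0%E.

Lemma covariance_geometric_decay s t :
  `|fine (covariance P (X s) (X t))| <= 3 * b ^+ 2 * rho ^+ (`|s - t|%N - m)%N.
Proof.
wlog st : s t / (s <= t)%N => [decay|].
  have [/decay//|/ltnW ts] := leqP s t.
  by rewrite covarianceC distnC decay.
rewrite distnEr// expr2; have /andP[rho0 rho1] := rho01.
have [mt|tm] := leqP m (t - s).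
  apply: (normr_covariance_approx_le _ _ _ (X2 s) (X2 t) (Y2 _ s) (Y2 _ t)) => //.
    by rewrite exprn_ge0//= exprn_ile1.
  by apply: covY; lia.
rewrite (_ : (t - s - m = 0)%N) ?expr0 ?mulr1; last by lia.
apply: le_trans (normr_covariance_le b0 b0 _ _ _ _) _ => //.
by rewrite ler_peMl ?mulr_ge0// ler1n.
Qed.

End geometric_decay.
End covariance_bounds.

Lemma expectation_sqr_centered_lincomb d (T : measurableType d) (R : realType)
    (P : probability T R) (I : finType) (f : I -> T -> R) (c : I -> R) :
  (forall i, f i \in Lfun P 2%:E) ->
  ('E_P[fun w => ((\sum_i c i * (f i w - fine 'E_P[f i]%E)) ^+ 2)%R]
   = (\sum_i \sum_j c i * c j * fine (covariance P (f i) (f j)))%:E)%E.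
Proof.
move=> f2; pose g i w := f i w - fine 'E_P[f i]%E.
have g2 i : g i \in Lfun P 2%:E.
  rewrite (_ : g i = f i - cst (fine 'E_P[f i]%E)) ?rpredB ?lee1n// => ?.
  exact: Lfun_cst.
have int_gg i j : P.-integrable setT (fun w => (g i w * g j w)%:E).
  by have /Lfun1_integrable := Lfun2_mul_Lfun1 (g2 i) (g2 j).
have E_gg i j : (\int[P]_w (g i w * g j w)%:E)%E = covariance P (f i) (f j).
  rewrite covariance.unlock -[RHS]/('E_P[(g i \* g j)%R])%E.
  by rewrite expectation.unlock.
rewrite -[X in ('E_P[X])%E]/(fun w => (\sum_i c i * g i w) ^+ 2).
rewrite unlock pair_bigA -sumEFin /=.
under eq_integral do rewrite expr2 big_distrlr pair_bigA -sumEFin /=.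
rewrite integral_sum//= => [|[i j]]; last first.
  have := integrableZl measurableT (c i * c j) (int_gg i j).
  by apply: eq_integrable => // w _; rewrite -EFinM mulrACA.
apply: eq_bigr => -[i j] _ /=.
rewrite EFinM covariance_fineK// -E_gg -integralZl//.
by apply: eq_integral => w _; rewrite -EFinM [in RHS]mulrACA.
Qed.

(** * Truncated moving averages *)

Section truncation.
Context dsp (T : measurableType dsp) (R : realType) (d q m L : nat).
Context (eps : 'I_L.+1 -> int -> 'I_d -> T -> R).
Context (phi : 'I_d -> 'I_L -> R) (r : 'I_L -> 'I_q -> R)
        (dist : ('I_q -> R) -> ('I_q -> R) -> R) (s : nat -> 'I_q -> R).
Implicit Type C : nat -> 'I_L.+1 -> 'M[R]_d.

Definition truncate_coef n C : nat -> 'I_L.+1 -> 'M[R]_d :=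
  fun j l => if (j < n)%N then C j l else 0.

Lemma MAproc_truncate_coef n C l t i w :
  MAproc eps (truncate_coef n C) l t i w =
  \sum_(j < n) \sum_(i' < d) C j l i i' * eps l (t - j%:Z) i' w.
Proof.
apply/cvg_lim => //; apply: cvg_near_cst; exists n => // N /= nN.
rewrite -(subnKC nN) big_split_ord /= [X in _ + X]big1 ?addr0 => [|j _].
  by apply: eq_bigr => j _; apply: eq_bigr => i' _; rewrite /truncate_coef ltn_ord.
by rewrite big1// => i' _; rewrite /truncate_coef ltnNge leq_addr mxE mul0r.
Qed.

(* [v] is the identity below, possibly onto a smaller sigma-algebra. *)
Lemma measurable_fun_MAproc dsp' (S : measurableType dsp') (v : S -> T) C l t i :
  (forall j i', C j l i i' != 0 -> measurable_fun setT (eps l (t - j%:Z) i' \o v)) ->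
  measurable_fun setT (MAproc eps C l t i \o v).
Proof.
move=> meps.
apply: (measurable_fun_limn (h := fun n w =>
  \sum_(j < n) \sum_(i' < d) C j l i i' * eps l (t - j%:Z) i' (v w))) => n.
apply: measurable_sum => j; apply: measurable_sum => i'.
have [->|C0] := eqVneq (C j l i i') 0.
  by under eq_fun do rewrite mul0r; exact: measurable_cst.
by apply: measurable_funM => //; exact: meps.
Qed.

Lemma measurable_fun_Umat dsp' (S : measurableType dsp') (v : S -> T) C t i (a : 'I_m.+1) :
  (forall l j i', C j l i i' != 0 ->
     measurable_fun setT (eps l (t%:Z - a%:Z - j%:Z) i' \o v)) ->
  measurable_fun setT (fun w => Umat m eps C phi r dist s t (v w) i a).
Proof.
move=> meps; under eq_fun do rewrite mxE.
apply: measurable_funD; last by apply: measurable_fun_MAproc => j i'; exact: meps.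
apply: measurable_sum => l; apply: measurable_funM => //.
by apply: measurable_fun_MAproc => j i'; exact: meps.
Qed.

Lemma measurable_fun_lipschitz_Umat dsp' (S : measurableType dsp') (v : S -> T) C t
    (h : 'M[R]_(d, m.+1) -> R) (LH : R) :
  0 <= LH -> (forall A B, `|h A - h B| <= LH * frob (A - B)) ->
  (forall l (a : 'I_m.+1) j i i', C j l i i' != 0 ->
     measurable_fun setT (eps l (t%:Z - a%:Z - j%:Z) i' \o v)) ->
  measurable_fun setT (fun w => h (Umat m eps C phi r dist s t (v w))).
Proof.
move=> LH0 h_lip meps; apply: (measurable_fun_lipschitz_mx LH0 h_lip) => i a.
by apply: measurable_fun_Umat => l j i'; exact: meps.
Qed.

Lemma Umat_truncate_coef0 C t w : Umat m eps (truncate_coef 0 C) phi r dist s t w = 0.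
Proof.
apply/matrixP => i a; rewrite !mxE /Ufield MAproc_truncate_coef big_ord0 addr0.
by apply: big1 => l _; rewrite MAproc_truncate_coef big_ord0 mulr0.
Qed.

Section truncation_error.
Context (mu : {measure set T -> \bar R}) (p M K rho : R).
Context (C : nat -> 'I_L.+1 -> 'M[R]_d).
Hypotheses (p_ge1 : 1 <= p) (rho01 : 0 <= rho < 1).
Hypotheses (meps : forall l t i, measurable_fun setT (eps l t i)).
Hypothesis (epsM : forall l t i, ('N[mu]_p%:E[EFin \o eps l t i] <= M%:E)%E).
Hypothesis (CK : forall j l i i', `|C j l i i'| <= K * rho ^+ j).
Hypothesis (dist01 : forall t l, 0 <= dist (s t) (r l) <= 1).

Local Notation MA := (MAproc eps C).
Local Notation MAn n := (MAproc eps (truncate_coef n C)).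
Local Notation U := (Umat m eps C phi r dist s).
Local Notation Un n := (Umat m eps (truncate_coef n C) phi r dist s).

Let mMA C' l t i : measurable_fun setT (MAproc eps C' l t i).
Proof. by apply: (measurable_fun_MAproc (v := id)) => j i' _; exact: meps. Qed.

Let mU C' t i a : measurable_fun setT (fun w => Umat m eps C' phi r dist s t w i a).
Proof. by apply: (measurable_fun_Umat (v := id)) => l j i' _; exact: meps. Qed.

Lemma Lnorm_MAproc_truncate_le n l t i :
  ('N[mu]_p%:E[EFin \o (MA l t i \- MAn n l t i)%R] <=
   (d%:R * K * M / (1 - rho) * rho ^+ n)%:E)%E.
Proof.
have K0 : 0 <= K by have := le_trans (normr_ge0 _) (CK 0 l i i); rewrite expr0 mulr1.
have M0 : 0 <= M by rewrite -lee_fin; apply: le_trans (epsM l t i); exact: Lnorm_ge0.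
pose a j w := \sum_(i' < d) C j l i i' * eps l (t - j%:Z) i' w.
have ma j : measurable_fun setT (a j).
  by apply: measurable_sum => i'; exact: measurable_funM.
have Na j : ('N[mu]_p%:E[EFin \o a j] <= (d%:R * K * M * rho ^+ j)%:E)%E.
  apply: le_trans (Lnorm_sum_le _ p_ge1 _ _) _; first by move=> i'; exact: measurable_funM.
  apply: (@le_trans _ _ (\sum_(i' < d) (K * rho ^+ j * M)%:E)%E).
    apply: lee_sum => i' _; rewrite LnormMl// EFinM.
    by rewrite lee_pmul ?lee_fin ?Lnorm_ge0.
  by rewrite sumEFin sumr_const card_ord lee_fin -mulr_natl; lra.
under eq_Lnorm do rewrite /= MAproc_truncate_coef.
apply: le_trans (Lnorm_limn_sum_tail_le mu n p_ge1 ma) _.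
apply: (@le_trans _ _ (\sum_(n <= j <oo) (d%:R * K * M * rho ^+ j)%:E)%E).
  by apply: lee_nneseries => // j _ _; exact: Lnorm_ge0.
by rewrite nneseries_geometric// ?mulr_ge0// lee_fin mulrAC.
Qed.

Lemma Lnorm_Umat_truncate_le n t i a :
  ('N[mu]_p%:E[EFin \o (fun w => U t w i a - Un n t w i a)%R] <=
   ((1 + \sum_l `|phi i l|) * (d%:R * K * M / (1 - rho) * rho ^+ n))%:E)%E.
Proof.
set b := (d%:R * K * M / (1 - rho) * rho ^+ n).
pose e l := MA l (t%:Z - a%:Z) i \- MAn n l (t%:Z - a%:Z) i.
have Ne l : ('N[mu]_p%:E[EFin \o e l] <= b%:E)%E by exact: Lnorm_MAproc_truncate_le.
have me l : measurable_fun setT (e l) by exact: measurable_funB.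
pose c l := phi i l * dist (s t) (r l).
have UE : (fun w => U t w i a - Un n t w i a) =
    (e ord0 \+ (fun w => \sum_(l < L) c l * e (lift ord0 l) w))%R.
  apply/funext => w; rewrite !mxE /Ufield /e /= opprD addrACA -sumrB addrC.
  by congr (_ + _); apply: eq_bigr => l _; rewrite mulrBr.
rewrite UE; apply: le_trans (minkowski _ _ _ p_ge1) _ => //.
  by apply: measurable_sum => l; exact: measurable_funM.
rewrite mulrDl mul1r EFinD leeD//.
apply: le_trans (Lnorm_sum_le _ p_ge1 _ _) _; first by move=> l; exact: measurable_funM.
rewrite mulr_suml -sumEFin; apply: lee_sum => l _.
rewrite LnormMl// EFinM lee_pmul ?lee_fin ?Lnorm_ge0//.
have /andP[dist0 dist1] := dist01 t l.
by rewrite normrM (ger0_norm dist0) ler_piMr.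
Qed.

Context (h : 'M[R]_(d, m.+1) -> R) (LH : R).
Hypothesis LH0 : 0 <= LH.
Hypothesis h_lip : forall A B, `|h A - h B| <= LH * frob (A - B).

Lemma Lnorm_lipschitz_truncate_le : exists2 b, 0 <= b & forall n t,
  ('N[mu]_p%:E[EFin \o (fun w => h (U t w) - h (Un n t w))%R] <= (b * rho ^+ n)%:E)%E.
Proof.
pose b i := (1 + \sum_l `|phi i l|) * (d%:R * K * M / (1 - rho)).
have entry_le n t i (a : 'I_m.+1) :
    ('N[mu]_p%:E[EFin \o (fun w => U t w i a - Un n t w i a)%R] <= (b i * rho ^+ n)%:E)%E.
  by have := Lnorm_Umat_truncate_le n t i a; rewrite mulrA.
have b0 i : 0 <= b i.
  have := entry_le 0%N 0%N i ord0; rewrite expr0 mulr1 -lee_fin.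
  exact/le_trans/Lnorm_ge0.
exists (LH * (\sum_i \sum_(a < m.+1) b i)).
  by rewrite mulr_ge0// sumr_ge0// => i _; rewrite sumr_ge0.
move=> n t; apply: le_trans (Lnorm_lipschitz_mx_le _ p_ge1 LH0 h_lip _ _) _ => //.
rewrite -mulrA EFinM lee_wpmul2l ?lee_fin// mulr_suml -sumEFin.
apply: lee_sum => i _; rewrite mulr_suml -sumEFin.
by apply: lee_sum => a _; exact: entry_le.
Qed.

End truncation_error.
End truncation.

Section short_memory.
Context dsp (T : measurableType dsp) (R : realType) (P : probability T R).
Context (d q m L : nat) (eps : 'I_L.+1 -> int -> 'I_d -> T -> R).
Context (C : nat -> 'I_L.+1 -> 'M[R]_d) (phi : 'I_d -> 'I_L -> R) (r : 'I_L -> 'I_q -> R)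
        (dist : ('I_q -> R) -> ('I_q -> R) -> R) (s : nat -> 'I_q -> R).
Context (h : 'M[R]_(d, m.+1) -> R) (LH : R).
Hypotheses (LH0 : 0 <= LH) (h_lip : forall A B, `|h A - h B| <= LH * frob (A - B)).
Hypothesis meps : forall l t i, measurable_fun setT (eps l t i).
Hypothesis ind : mutually_indep_vecs P (fun lt : 'I_L.+1 * int => eps lt.1 lt.2).

Local Notation hU C t := (fun w => h (Umat m eps C phi r dist s t w)).

(* [hU (truncate_coef n C) t] is a function of the innovations at the times
   [t - (n + m) + 1, ..., t]. *)
Lemma indep_lipschitz_truncate n t1 t2 : (t1 + (n + m) <= t2)%N ->
  indep_rv P (hU (truncate_coef n C) t1) (hU (truncate_coef n C) t2).
Proof.
move=> t12; pose J : finType := ('I_L.+1 * 'I_(n + m))%type.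
pose window (t : nat) (i : 'I_#|J|) : 'I_L.+1 * int :=
  ((enum_val i : J).1, t%:Z - (enum_val i : J).2%:Z).
have window_inj t : injective (window t).
  move=> i j [lij tij]; apply: enum_val_inj.
  have : (enum_val i : J).2 = (enum_val j : J).2 by apply: val_inj => /=; lia.
  by case: (enum_val i) lij => a b /= ->; case: (enum_val j) => a' b' /= ->.
pose window_sigma t := g_sigma_algebraType
  (cylinders (fun lt : 'I_L.+1 * int => eps lt.1 lt.2) (window t)).
have mh t : measurable_fun (setT : set (window_sigma t)) (hU (truncate_coef n C) t).
  apply: (measurable_fun_lipschitz_Umat phi r dist s
    (v := id : window_sigma t -> T) LH0 h_lip) => l a j i i'.
  rewrite /truncate_coef; case: ltnP => [jn _|_]; last by rewrite mxE eqxx.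
  have aj : (a + j < n + m)%N by have := ltn_ord a; lia.
  have := measurable_fun_cylinders (X := fun lt : 'I_L.+1 * int => eps lt.1 lt.2)
    (f := window t) (enum_rank ((l, Ordinal aj) : J)) i'.
  by rewrite /window enum_rankK /= PoszD opprD addrA.
apply: (indep_rv_cylinders ind _ (window_inj t1) (window_inj t2) _ (mh t1) (mh t2)).
  by move=> [l t] i; exact: meps.
move=> i j [_]; have := ltn_ord (enum_val j : J).2.
by move: (nat_of_ord _) (nat_of_ord _) => a b; lia.
Qed.

Variables (M K rho : R).
Hypothesis rho01 : 0 <= rho < 1.
Hypothesis epsM : forall l t i, ('N[P]_2%:E[EFin \o eps l t i] <= M%:E)%E.
Hypothesis CK : forall j l i i', `|C j l i i'| <= K * rho ^+ j.
Hypothesis dist01 : forall t l, 0 <= dist (s t) (r l) <= 1.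

Lemma covariance_lipschitz_Umat_decay :
  (forall t, hU C t \in Lfun P 2%:E) /\
  exists2 B, 0 <= B & forall t1 t2,
    `|fine (covariance P (hU C t1) (hU C t2))| <= B * rho ^+ (`|t1 - t2|%N - m)%N.
Proof.
have mhU C' t : measurable_fun setT (hU C' t).
  apply: (measurable_fun_lipschitz_Umat phi r dist s (v := id) LH0 h_lip) => l a j i i' _.
  exact: meps.
have [b b0 error_le] := Lnorm_lipschitz_truncate_le phi (ler1n R 2) rho01 meps epsM
  CK dist01 LH0 h_lip.
pose X t := hU C t; pose Y n t := hU (truncate_coef n C) t.
have XY2 n t : (X t \- Y n t)%R \in Lfun P 2%:E.
  by apply: Lfun_Lnorm_le (error_le n t); apply: measurable_funB; exact: mhU.
have Y0 t : Y 0%N t = cst (h 0) by apply/funext => w; rewrite /Y Umat_truncate_coef0.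
have X2 t : X t \in Lfun P 2%:E.
  rewrite (_ : X t = (X t \- Y 0%N t) + cst (h 0))%R; last first.
    by apply/funext => w; rewrite Y0 fctE /= subrK.
  by rewrite rpredD ?lee1n// => ?; exact: Lfun_cst.
have Y2 n t : Y n t \in Lfun P 2%:E.
  rewrite (_ : Y n t = X t - (X t \- Y n t))%R; last first.
    by apply/funext => w; rewrite !fctE /= subKr.
  by rewrite rpredB ?lee1n// => ?; exact: XY2.
have VXY n t : ('V_P[(X t \- Y n t)%R] <= ((b * rho ^+ n) ^+ 2)%:E)%E.
  by apply: variance_le_Lnorm; [exact: XY2|exact: error_le].
have VX t : ('V_P[X t] <= (b ^+ 2)%:E)%E.
  by have := VXY 0%N t; rewrite Y0 varianceB_cst_r// expr0 mulr1.
have covY n t1 t2 : (t1 + (n + m) <= t2)%N -> covariance P (Y n t1) (Y n t2) = 0%E.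
  by move=> t12; apply: indep_rv_covariance0 => //; exact: indep_lipschitz_truncate.
split=> //; exists (3 * b ^+ 2); first by rewrite mulr_ge0 ?sqr_ge0.
have rho01' : 0 <= rho <= 1 by case/andP: rho01 => -> /ltW ->.
exact: covariance_geometric_decay b0 rho01' X2 Y2 VX VXY covY.
Qed.

End short_memory.

(** * Consistency under summable covariances *)

Lemma sum_distn_le (R : numDomainType) (g : nat -> R) (G : R) (n s : nat) :
  (forall k, 0 <= g k) -> (forall N, \sum_(k < N) g k <= G) ->
  \sum_(t < n) g `|s - t|%N <= 2 * G.
Proof.
move=> g0 gG; apply: (@le_trans _ _ (\sum_(t < s + n) g `|s - t|%N)).
  by rewrite addnC [leRHS]big_split_ord /= lerDl sumr_ge0.
rewrite big_split_ord /= mulr_natl mulr2n lerD//; last first.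
  by apply: le_trans (gG n); apply: ler_sum => t _; rewrite distnEr ?leq_addr// addKn.
apply: le_trans (gG s.+1); rewrite big_ord_recl /= ler_wpDl//.
rewrite (reindex_inj rev_ord_inj) /=; apply: ler_sum => t _.
by rewrite distnEl ?leq_subr// subKn.
Qed.

Lemma sum_expr_subn_le (R : realFieldType) (rho : R) m N : 0 <= rho < 1 ->
  \sum_(k < N) rho ^+ (k - m)%N <= m%:R + (1 - rho)^-1.
Proof.
move=> /andP[rho0 rho1].
apply: (@le_trans _ _ (\sum_(k < m + N) rho ^+ (k - m)%N)).
  by rewrite addnC [leRHS]big_split_ord /= lerDl sumr_ge0// => k _; rewrite exprn_ge0.
rewrite big_split_ord /= lerD//.
  rewrite (eq_bigr (fun=> 1)) ?sumr_const ?card_ord// => k _.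
  by rewrite (eqP (ltnW (ltn_ord k))).
under eq_bigr do rewrite addKn.
rewrite -[leRHS]mul1r ler_pdivlMr ?subr_gt0// mulrC -opprB mulNr -subrX1 opprB.
by rewrite gerBl exprn_ge0.
Qed.

Lemma markov_sqr d (T : measurableType d) (R : realType) (P : probability T R)
    (Y : T -> R) (e : R) : 0 < e -> measurable_fun setT Y ->
  ((e ^+ 2)%:E * P [set w | (e <= `|Y w|)%R] <= 'E_P[fun w => (Y w ^+ 2)%R])%E.
Proof.
move=> e0 mY.
pose YRV : {RV P >-> R} := HB.pack Y (isMeasurableFun.Build _ _ _ _ Y mY).
have -> : (fun w => Y w ^+ 2) = (fun x => x ^+ 2) \o (fun x => `|x|) \o Y.
  by apply/funext => w; rewrite /= real_normK// num_real.
apply: (@markov _ _ _ P YRV (fun x => x ^+ 2)) => //.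
- by move=> x _; exact: sqr_ge0.
- by move=> x y; rewrite !nnegrE => x0 y0; rewrite ler_sqr.
Qed.

Section least_squares_consistency.
Context d (T : measurableType d) (R : realType) (P : probability T R).
Variables (f : nat -> T -> R) (g : nat -> R) (G : R).
Hypothesis f2 : forall t, f t \in Lfun P 2%:E.
Hypothesis g0 : forall k, 0 <= g k.
Hypothesis gG : forall N, \sum_(k < N) g k <= G.
Hypothesis cov_le : forall s t, `|fine (covariance P (f s) (f t))| <= g `|s - t|%N.

Definition centered t w := f t w - fine 'E_P[f t]%E.

Lemma measurable_fun_centered t : measurable_fun setT (centered t).
Proof.
by apply: measurable_funB => //; exact: (set_mem (sub_Lfun_mfun (f2 t))).
Qed.

Lemma expectation_sqr_weighted_le n (c : 'I_n -> R) (K : R) : (forall i, `|c i| <= K) ->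
  ('E_P[fun w => ((\sum_(i < n) c i * centered i w) ^+ 2)%R] <=
   (K ^+ 2 * (n%:R * (2 * G)))%:E)%E.
Proof.
move=> cK; rewrite (expectation_sqr_centered_lincomb c (fun i : 'I_n => f2 i)) lee_fin.
apply: (@le_trans _ _ (\sum_(i < n) K ^+ 2 * \sum_(j < n) g `|i - j|%N)); last first.
  rewrite -mulr_sumr ler_wpM2l ?sqr_ge0// mulr_natl -[n in leRHS]card_ord -sumr_const.
  by apply: ler_sum => i _; exact: sum_distn_le.
apply: ler_sum => i _; rewrite mulr_sumr; apply: ler_sum => j _.
by rewrite (le_trans (ler_norm _))// !normrM expr2 !ler_pM// mulr_ge0.
Qed.

Lemma measurable_fun_mulmx_centered m n (A : 'M[R]_(m, n)) i :
  measurable_fun setT (fun w => (A *m \col_(j < n) centered j w) i 0).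
Proof.
apply: measurable_fun_mulmxr => j; under eq_fun do rewrite mxE.
exact: measurable_fun_centered.
Qed.

Lemma expectation_sqr_norm2_le n p (X : 'M[R]_(n, p)) (K : R) :
  (forall i j, `|X i j| <= K) ->
  ('E_P[fun w => (norm2 (X^T *m \col_(i < n) centered i w) ^+ 2)%R] <=
   (p%:R * (K ^+ 2 * (n%:R * (2 * G))))%:E)%E.
Proof.
move=> XK; pose score k w := (X^T *m \col_(i < n) centered i w) k 0.
have scoreE k w : score k w = \sum_(i < n) X i k * centered i w.
  by rewrite /score mxE; apply: eq_bigr => i _; rewrite !mxE.
rewrite expectation.unlock.
under eq_integral do rewrite norm2_sqr dot_mxE -sumEFin.
rewrite ge0_integral_sum//; last 2 first.
- move=> k; apply/measurable_EFinP.
  by apply: measurable_funM; exact: measurable_fun_mulmx_centered.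
- by move=> k w _; rewrite lee_fin -expr2 sqr_ge0.
rewrite mulr_natl -[p in leRHS]card_ord -sumr_const -sumEFin.
apply: lee_sum => k _; have /= := expectation_sqr_weighted_le (fun i => XK i k).
rewrite expectation.unlock; under eq_integral do rewrite -scoreE expr2.
by [].
Qed.

Lemma ols_deviation_probability_le n p (X : 'M[R]_(n, p)) (b : 'cV[R]_p) (K k e : R) :
  (forall i j, `|X i j| <= K) -> 0 < k -> 0 < e ->
  (forall l, eigenvalue (X^T *m X) l -> k <= l) ->
  (P [set w | (e < norm2 (ols X (\col_(i < n) ((X *m b) i 0 + centered i w)) - b))%R] <=
   (p%:R * (K ^+ 2 * (n%:R * (2 * G))) / (k * e) ^+ 2)%:E)%E.
Proof.
move=> XK k0 e0 k_le; pose noise w := \col_(i < n) centered i w.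
have obsE w : \col_(i < n) ((X *m b) i 0 + centered i w) = X *m b + noise w.
  by apply/colP => i; rewrite !mxE.
under [X in P X]eq_set do rewrite obsE.
pose Z w := norm2 (ols X (X *m b + noise w) - b).
have mZ : measurable_fun setT Z.
  apply: measurable_fun_norm2 => i; rewrite /ols.
  under eq_fun do rewrite mulmxDr mxE [X in X + _]mxE.
  apply: measurable_funD => //; apply: measurable_funD => //.
  exact: measurable_fun_mulmx_centered.
pose W w := norm2 (X^T *m noise w).
have mW : measurable_fun setT W.
  by apply: measurable_fun_norm2 => i; exact: measurable_fun_mulmx_centered.
have ZW w : e < Z w -> k * e <= `|W w|.
  move=> eZ; rewrite ger0_norm ?sqrtr_ge0//.
  apply: le_trans (ols_error_le b (noise w) k0 k_le).
  by rewrite ler_wpM2l ?ltW.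
have ke0 : 0 < k * e by rewrite mulr_gt0.
rewrite mulrC EFinM lee_pdivlMl ?exprn_gt0//.
apply: le_trans (expectation_sqr_norm2_le XK); apply: le_trans (markov_sqr P ke0 mW).
rewrite lee_wpmul2l ?lee_fin ?sqr_ge0// le_measure ?inE//; rewrite -[X in measurable X]setTI.
  have mZE : measurable_fun setT (EFin \o Z) by exact/measurable_EFinP.
  exact: (emeasurable_fun_o_infty measurableT mZE e%:E).
have mWE : measurable_fun setT (abse \o (EFin \o W)).
  by apply: measurableT_comp => //; exact/measurable_EFinP.
exact: (emeasurable_fun_c_infty measurableT mWE (k * e)%:E).
Qed.

End least_squares_consistency.

Lemma natr_ratio_cvg0 (R : realType) (p : nat -> nat) :
  (fun T : nat => (p T)%:R * ln (p T)%:R / T%:R) @ \oo --> (0 : R) ->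
  (fun T : nat => (p T)%:R / T%:R) @ \oo --> (0 : R).
Proof.
move=> plnp; have le_1Dxlnx (x : R) : 0 <= x -> x <= 1 + x * ln x.
  rewrite le_eqVlt => /predU1P[<-|x0]; first by rewrite mul0r addr0.
  have := @le_ln1Dx R (x^-1 - 1); rewrite [1 + _]addrC subrK lnV ?posrE//.
  rewrite ltrBrDl subrr invr_gt0 => /(_ x0) ln_le.
  have := ler_wpM2l (ltW x0) ln_le.
  by rewrite mulrBr mulfV ?lt0r_neq0// mulrN; lra.
apply: (@squeeze_cvgr _ _ _ _ (cst 0)
  (fun T : nat => 1 / T%:R + (p T)%:R * ln (p T)%:R / T%:R)).
- apply: nearW => T /=; rewrite divr_ge0//= -mulrDl.
  by rewrite ler_wpM2r ?invr_ge0 ?le_1Dxlnx.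
- exact: cvg_cst.
- rewrite -[X in _ --> X](addr0 (0 : R)); apply: cvgD => //.
  rewrite [X in X @ _ --> _](_ : _ = fun n : nat => n%:R^-1); last first.
    by apply/funext => n; rewrite div1r.
  by rewrite -(@cvg_shiftS R (fun n : nat => n%:R^-1)); exact: cvg_harmonic.
Qed.

Lemma ols_consistent d (Omega : measurableType d) (R : realType) (P : probability Omega R)
    (f : nat -> Omega -> R) (g : nat -> R) (G K a : R) (p : nat -> nat)
    (X : forall T, 'M[R]_(T, p T)) (beta : forall T, 'cV[R]_(p T)) :
  (forall t, f t \in Lfun P 2%:E) ->
  (forall k, 0 <= g k) -> (forall N, \sum_(k < N) g k <= G) ->
  (forall s t, `|fine (covariance P (f s) (f t))| <= g `|s - t|%N) ->
  (forall T i j, `|X T i j| <= K) -> 0 < a ->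
  (forall T, (0 < T)%N -> forall l, eigenvalue (T%:R^-1 *: ((X T)^T *m X T)) l -> a <= l) ->
  (fun T : nat => (p T)%:R / T%:R) @ \oo --> (0 : R) ->
  forall e : R, 0 < e ->
  (fun T : nat => P [set w | e < norm2 (ols (X T)
     (\col_(i < T) ((X T *m beta T) i 0 + centered P f i w)) - beta T)]) @ \oo --> 0%E.
Proof.
move=> f2 g0 gG cov_le XK a0 a_le pT e e0.
pose c := K ^+ 2 * (2 * G) / (a * e) ^+ 2.
apply: (@squeeze_cvge _ _ _ _ (fun=> 0%E) _ (fun T : nat => (c * ((p T)%:R / T%:R))%:E)).
- exists 1%N => // T T0; rewrite measure_ge0/=.
  have TR0 : 0 < T%:R :> R by rewrite ltr0n.
  have aT_le l : eigenvalue ((X T)^T *m X T) l -> a * T%:R <= l.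
    move=> /eigenvalueP[v vG v0]; rewrite -ler_pdivlMr// mulrC.
    apply: (a_le T T0); apply/eigenvalueP; exists v => //.
    by rewrite -scalemxAr vG scalerA.
  have aT_gt0 : 0 < a * T%:R by rewrite mulr_gt0.
  apply: le_trans
    (ols_deviation_probability_le f2 g0 gG cov_le (beta T) (XK T) aT_gt0 e0 aT_le) _.
  rewrite lee_fin le_eqVlt; apply/orP; left; apply/eqP; rewrite /c.
  by field; rewrite ?gt_eqF.
- exact: cvg_cst.
- apply: cvg_EFin; first exact: nearW.
  by rewrite -[X in _ --> X](mulr0 c); apply: cvgM => //; exact: cvg_cst.
Qed.

Theorem theorem4 (R : realType) (dsp : measure_display) (Omega : measurableType dsp)
  (P : probability Omega R)
  (d q m L : nat)
  (eps u : 'I_L.+1 -> int -> 'I_d -> Omega -> R)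
  (Sig Sroot : 'I_L.+1 -> int -> 'M[R]_d)
  (C : nat -> 'I_L.+1 -> 'M[R]_d)
  (phi : 'I_d -> 'I_L -> R) (r : 'I_L -> 'I_q -> R)
  (dist : ('I_q -> R) -> ('I_q -> R) -> R)
  (H : 'I_d -> 'M[R]_(d, m.+1) -> R)
  (s : nat -> 'I_q -> R)
  (p : nat -> nat)
  (X : forall T : nat, 'M[R]_(T, p T))
  (beta : forall T : nat, 'cV[R]_(p T))
  (nu : 'I_d) :
  (* spatial locations, sites and the function d *)
  (forall t i, 0 <= s t i <= 1) ->
  (forall l i, 0 <= r l i <= 1) ->
  (forall a b : 'I_q -> R, (forall i, 0 <= a i <= 1) -> (forall i, 0 <= b i <= 1) ->
     0 <= dist a b <= 1) ->
  (* (E1) *)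
  (forall l t k, measurable_fun setT (eps l t k)) ->
  (forall l t k, measurable_fun setT (u l t k)) ->
  mutually_indep_vecs P (fun lt : 'I_L.+1 * int => eps lt.1 lt.2) ->
  (forall l t k, P.-integrable setT (EFin \o eps l t k) /\ ('E_P[eps l t k] = 0)%E) ->
  (forall l t, posdef (Sig l t)) ->
  (forall l t, posdef (Sroot l t) /\ Sroot l t *m Sroot l t = Sig l t) ->
  (forall l t k w, eps l t k w = \sum_(i < d) Sroot l t k i * u l t i w) ->
  (forall l t k, P.-integrable setT (EFin \o u l t k) /\ ('E_P[u l t k] = 0)%E) ->
  (forall l t, indep_coords P (u l t)) ->
  (* (E2) and (E7), with a common delta > 0 *)
  (exists delta : R, 0 < delta /\
     (exists M : R, forall l t k,
        (\int[P]_w ((`|eps l t k w| `^ (2 + delta))%:E) <= M%:E)%E) /\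
     (exists LH : R, forall nu' (A B : 'M[R]_(d, m.+1)),
        `|H nu' A - H nu' B| <= LH * frob (A - B)) /\
     (exists Xi : 'I_d * 'I_m.+1 -> Omega -> R,
        (forall ik, measurable_fun setT (Xi ik)) /\
        indep_of_family P Xi
          (fun tsk : int * ('I_q -> R) * 'I_d =>
             Ufield eps C phi r dist tsk.1.1 tsk.1.2 tsk.2) /\
        exists M : R, forall nu',
          (\int[P]_w ((`|H nu' (\matrix_(i < d, k < m.+1) Xi (i, k) w)| `^ (2 + delta))%:E)
             <= M%:E)%E)) ->
  (* (E3) *)
  (d = 1%N -> exists M : R, forall l t k,
     ('E_P[fun w => (eps l t k w ^+ 2)%R] <= M%:E)%E) ->
  (* (E4) *)
  (d = 1%N -> exists sig0 : R, 0 < sig0 /\ forall t k,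
     ((sig0 ^+ 2)%:E <= 'E_P[fun w => (eps ord0 t k w ^+ 2)%R])%E) ->
  ((1 < d)%N -> exists lam : R, 0 < lam /\ forall t a,
     eigenvalue (Sig ord0 t) a -> lam <= a) ->
  (* (E5) *)
  (forall l k, exists pd : int -> R -> R,
     (forall t, measurable_fun setT (pd t)) /\ (forall t z, 0 <= pd t z) /\
     (forall t (B : set R), measurable B ->
        P (eps l t k @^-1` B) = (\int[lebesgue_measure]_(z in B) (pd t z)%:E)%E) /\
     exists K : R, forall t (x : R),
       (\int[lebesgue_measure]_z ((`|pd t (z + x) - pd t z|)%:E) <= (K * `|x|)%:E)%E) ->
  (* (R) *)
  (exists K : R, forall T i j, `|X T i j| <= K) ->
  (exists (Sx : forall T : nat, 'M[R]_(p T)) (eta Cc a b : R),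
     0 <= eta /\ 0 < a /\ a <= b /\
     forall T : nat, (0 < T)%N ->
       posdef (Sx T) /\
       spec_norm_le ((T%:R)^-1 *: ((X T)^T *m X T) - Sx T)
                    (Cc * ((p T)%:R `^ eta) / Num.sqrt T%:R) /\
       (forall a', eigenvalue ((T%:R)^-1 *: ((X T)^T *m X T)) a' -> a <= a' <= b)) ->
  (* full rank design *)
  (forall T : nat, (0 < T)%N -> \rank (X T) = p T) ->
  (* geometric decay of the coefficients *)
  (exists (K rho : R), 0 <= rho < 1 /\
     forall j l i k, `|C j l i k| <= K * rho ^+ j) ->
  (* |x_tj eps_t^(nu')| <= 1 *)
  (forall (T : nat) (i : 'I_T) (j : 'I_(p T)) nu' w,
     `|X T i j * errobs P eps C phi r dist H s i.+1 nu' w| <= 1) ->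
  (* growth conditions *)
  (fun T : nat => (p T)%:R * ln (p T)%:R / T%:R) @ \oo --> (0 : R) ->
  (fun T : nat => ln (T%:R) ^+ 2 / Num.sqrt (p T)%:R) @ \oo --> (0 : R) ->
  (* consistency of the OLS estimator for coordinate nu *)
  forall e : R, 0 < e ->
    (fun T : nat =>
       P [set w | e < norm2 (ols (X T)
              (\col_(i < T) ((X T *m beta T) i 0 + errobs P eps C phi r dist H s i.+1 nu w))
              - beta T)]) @ \oo --> 0%E.
Proof.
move=> s01 r01 dist01 meps _ ind _ _ _ _ _ _ [delta [delta0 [[M epsM] [[LH H_lip] _]]]].
move=> _ _ _ _ [Kx XK] [? [? [? [a [? [_ [a0 [_ eig_le]]]]]]]] _ [K [rho [rho01 CK]]] _.
move=> /natr_ratio_cvg0 pT _.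
have epsN l t i : ('N[P]_2%:E[EFin \o eps l t i] <= ((1 + M) `^ 2^-1)%:E)%E.
  by apply: Lnorm_le_moment (epsM l t i) => //; rewrite ltr0n lerDl ltW.
have HnuL A B : `|H nu A - H nu B| <= `|LH| * frob (A - B).
  by apply: le_trans (H_lip _ _ _) _; rewrite ler_wpM2r ?sqrtr_ge0 ?ler_norm.
have [f2 [B B0 cov_le]] := covariance_lipschitz_Umat_decay phi (normr_ge0 LH) HnuL meps ind
  rho01 epsN CK (fun t l => dist01 _ _ (s01 t) (r01 l)).
have /andP[rho0 _] := rho01.
apply: (@ols_consistent _ _ _ P
  (fun t w => H nu (Umat m eps C phi r dist s t.+1 w))
  (fun k => B * rho ^+ (k - m)%N) (B * (m%:R + (1 - rho)^-1)) Kx a) => //.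
- by move=> k; rewrite mulr_ge0 ?exprn_ge0.
- by move=> N; rewrite -mulr_sumr ler_wpM2l ?sum_expr_subn_le.
- by move=> t1 t2; rewrite -(distnDl 1); exact: cov_le.
- by move=> T T0 l /(proj2 (proj2 (eig_le T T0)))/andP[].
Qed.
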